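(* In every execution of the MonadBFT protocol (specified in the context) with $n=3f+1$ validators of which at most $f$ are Byzantine, no two correct validators commit different blocks at the same log position (height) in their local logs.
   Context: MODEL. There are $n=3f+1$ validators; at most $f$ are Byzantine (arbitrary behaviour), the others are correct and follow the protocol. Channels are point-to-point, authenticated and reliable. The network is partially synchronous: there are an unknown time GST and a known $\Delta>0$ such that a message sent at time $\tau$ between correct validators is delivered by $\max(\tau,\mathrm{GST})+\Delta$. ''Broadcast'' means send to all validators (including oneself). Local computation takes no time. Signatures and aggregate signatures are unforgeable; the hash function $H$ is treated as collision-free. An aggregate of $2f+1$ signatures means signatures of $2f+1$ distinct validators. Views are positive integers; each view $v$ has a leader, assigned round-robin. A validator stores all proposals it receives; on obtaining a QC it is assumed also to obtain the proposal the QC points to (and ancestors as needed). $\bot$ denotes an absent field. A correct leader issues at most one proposal per view. DATA. Block $B=\langle block\_view, payload, payload\_hash, qc, block\_hash\rangle$ with $block\_hash=H(block\_view,payload\_hash,qc)$; its header is $B$ without $payload$. Vote $\langle view, block\_hash, proposal\_id,\sigma\rangle$, valid if $proposal\_id=H(block\_hash,view)$ and $\sigma$ is a valid signature on the other fields. QC $\langle view, block\_hash, proposal\_id,\Sigma\rangle$, valid if $proposal\_id=H(block\_hash,view)$ and $\Sigma$ aggregates $2f+1$ signatures on the other fields; it points to any proposal with the same $proposal\_id$. Proposal $p=\langle view, proposal\_id, block,\sigma,tc,nec\rangle$ with $proposal\_id=H(block.block\_hash,view)$, $\sigma$ the leader's signature on $proposal\_id$ ($tc,nec$ possibly $\bot$).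 The tip of $p$ is $p$ with its block replaced by the block header. Timeout message $M=\langle view, tip, tip\_vote, qc, last\_cer,\sigma\rangle$. Timeout certificate (TC) $\langle view, tips\_views, high\_tip, qcs\_views, high\_qc,\Sigma\rangle$, where $tips\_views,qcs\_views$ give for each of $2f+1$ contributing validators the view of the reported tip ($\bot$, counted as $0$ in maxima, if it reported a QC) and the view of the reported QC (of the QC in the tip's header if it reported a tip). No-endorsement certificate (NEC) $\langle view, high\_tip\_qc\_view,\Sigma\rangle$. There are a genesis block and a genesis tip and genesis QC of view $0$, valid without signatures; initially they are $local\_tip$ and $last\_qc$. VALIDITY. A header is valid if its $qc$ is valid and its $block\_hash$ is correct; a block is valid if additionally $payload\_hash=H(payload)$. fresh($p$): $p.block.qc.view=p.view-1$, or $p.nec\ne\bot$, or ($p.tc\neq\bot$ and $p.tc.high\_qc\ne\bot$). Valid fresh tip $T$: valid header, correct $proposal\_id$, $\sigma$ by the leader of $T.view$, $header.block\_view=T.view>header.qc.view$, and: if $T.view=header.qc.view+1$ then $T.tc=T.nec=\bot$; otherwise $T.tc\neq\bot$ is valid with $T.view=T.tc.view+1$, and either ($T.nec=\bot$, $T.tc.high\_qc\ne\bot$ and $header.qc=T.tc.high\_qc$) or ($T.nec$ is valid, $T.view=T.nec.view$ and $header.qc.view=T.nec.high\_tip\_qc\_view$). Valid proposal $p$: valid block, correct $proposal\_id$, $\sigma$ by the leader of $p.view$, $p.view\ge p.block.block\_view$, $p.view>p.block.qc.view$, and: if fresh($p$), the tip of $p$ is a valid fresh tip; otherwise (''reproposal'')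 $p.view>p.block.block\_view$, $p.tc\neq\bot$ is valid, $p.view=p.tc.view+1$, $p.tc.high\_tip\ne\bot$, and the header of $p.block$ equals $p.tc.high\_tip$'s header. (So a valid proposal is fresh iff $p.view=p.block.block\_view$.) Valid timeout message $M$: $last\_cer$ is a valid QC or TC with $last\_cer.view=M.view-1$; exactly one of $tip,qc$ is non-$\bot$; if $tip\neq\bot$: $tip\_vote$ is a valid vote with $tip\_vote.view=M.view$, $tip$ is a valid fresh tip with $tip.view\le M.view$, $\sigma$ signs $(M.view,tip.view,tip.header.qc.view)$; if $qc\ne\bot$: $qc$ is valid, $qc.view<M.view$, $\sigma$ signs $(M.view,\bot,qc.view)$. Valid TC $tc$: $\Sigma$ aggregates $2f+1$ timeout signatures certifying $view,tips\_views,qcs\_views$; and either ($high\_qc\ne\bot$ is valid, $high\_tip=\bot$, $high\_qc.view<tc.view$, $\max(tips\_views)\le high\_qc.view=\max(qcs\_views)$) or ($high\_qc=\bot$, $high\_tip$ is a valid fresh tip, $high\_tip.view\le tc.view$, $qcs\_views[i]<tips\_views[i]$ whenever $tips\_views[i]\ne\bot$, no $tips\_views[i]>high\_tip.view$, no $i$ with $tips\_views[i]=high\_tip.view$ and $qcs\_views[i]>high\_tip.header.qc.view$, and $high\_tip.view>\max(qcs\_views)$). Valid NEC: $high\_tip\_qc\_view<view-1$ and $\Sigma$ aggregates $2f+1$ signatures on $(view,high\_tip\_qc\_view)$. LOCAL STATE of validator $i$: $cur\_view$, $local\_tip$, $highest\_voted\_view$, $last\_qc$, $last\_tc$, collected votes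 and timeouts, and a timer. At start every validator performs Enter(genesis QC), entering view $1$, and the leader of view 1 performs ProposeQC(genesis QC). PROCEDURES. Enter($c$) ($c$ a QC or TC): if $c.view\ge cur\_view$, set $cur\_view:=c.view+1$, restart the timer, and set $last\_qc:=c$ (QC) or $last\_tc:=c$ (TC). Commit($qc$): let $parent$ be the proposal $qc$ points to and $gp$ the proposal $parent.block.qc$ points to; if fresh($parent$), speculatively commit $parent.block$; if $qc.view=parent.block.qc.view+1$, commit $gp.block$ (and all its ancestors). ProposeQC($qc$): broadcast a proposal for $cur\_view$ with a new block $B$, $B.block\_view=cur\_view$, $B.qc=qc$, and $tc=nec=\bot$. ProposeTC($tc$): if $tc.high\_qc\neq\bot$, broadcast a proposal for $cur\_view$ with a new block with $qc=tc.high\_qc$, this $tc$, $nec=\bot$; else if the block of $tc.high\_tip$ is available, broadcast a proposal for $cur\_view$ containing that same block, this $tc$, $nec=\bot$; else run Recover($tc$): if it returns a proposal, repropose its block as before; if it returns an NEC, broadcast a proposal with a new block with $qc=tc.high\_tip.header.qc$, this $tc$, and this $nec$. Recover($tc$): broadcast $\langle\mathsf{NERequest},tc\rangle$, send $\langle\mathsf{ProposalRequest},tc\rangle$ to $\kappa$ validators and, every $\Theta_{interval}$ time, to $\kappa$ further ones; return the first received proposal with $proposal\_id=tc.high\_tip.proposal\_id$, or an NEC with view $tc.view+1$ and $high\_tip\_qc\_view=tc.high\_tip.header.qc.view$ once $2f+1$ validators sent valid NE signatures on this pair; abort if Recover is called for a higher view. BroadcastQC($qc$): broadcast $qc$ if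 not yet done. HANDLERS (messages of a view smaller than indicated, or invalid, are ignored). (1) On a valid proposal $p$ from the leader of $p.view\ge cur\_view$: Enter($p.tc$) if $p.tc\ne\bot$, else Enter($p.block.qc$); if $p.block.qc.view=p.view-1$, then BroadcastQC($p.block.qc$) if $i$ is the leader of view $p.block.qc.view$, and send $p.block.qc$ to that leader; Commit($p.block.qc$); if $p.view>highest\_voted\_view$: set $local\_tip$ to the tip of $p$ if fresh($p$) and to $p.tc.high\_tip$ otherwise, send a vote for ($cur\_view$, block hash of $local\_tip$) to the leaders of views $cur\_view$ and $cur\_view+1$, and set $highest\_voted\_view:=cur\_view$. (2) On a valid vote with view $v\ge cur\_view$, if $i$ leads $v$ or $v+1$: once $2f+1$ votes with the same $proposal\_id$ are collected, form the QC $qc$; Enter($qc$); Commit($qc$); BroadcastQC($qc$) if $i$ leads $v$, else ProposeQC($qc$). (3) On a valid QC $qc$ from $j$ with $qc.view\ge cur\_view$: if $j$ leads $qc.view$: Enter($qc$), Commit($qc$), send $qc$ to the leader of $qc.view+1$; if $i$ leads $qc.view$: BroadcastQC($qc$); if $i$ leads $qc.view+1$: Enter($qc$), Commit($qc$), ProposeQC($qc$). (4) On timing out in $cur\_view=v$ (at most once per view; when the timer reaches $\Theta_{view}$ or when triggered in (5)): $highest\_voted\_view:=v$; broadcast a timeout message for view $v$ with $last\_cer=last\_qc$ if $last\_qc.view=v-1$ and $last\_cer=last\_tc$ otherwise; if $local\_tip.view\le last\_qc.view$ it has $qc=last\_qc$, $tip=tip\_vote=\bot$; otherwise $tip=local\_tip$,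 $tip\_vote$ a vote for ($v$, block hash of $local\_tip$), $qc=\bot$. (5) On a valid timeout message $M$ with $M.view\ge cur\_view$: let $c=M.last\_cer$; if $c$ is a TC and $i$ has broadcast neither a timeout message nor a TC for $c.view$, broadcast $c$; Enter($c$); if $i$ leads $c.view+1$ and has issued no proposal for it, ProposeQC($c$) or ProposeTC($c$) according to the type of $c$; if $c$ is a QC: BroadcastQC($c$) if $i$ leads $c.view$, send $c$ to the leaders of $c.view$ and $c.view+1$, Commit($c$). Then: if $M.tip\neq\bot$, record $M.tip\_vote$; if $2f+1$ tip votes with the same $proposal\_id$ are recorded, form the QC $qc$, Enter($qc$), Commit($qc$), ProposeQC($qc$) if $i$ leads $qc.view+1$, and stop. Otherwise record $M$; when $f+1$ timeout messages for $M.view$ are recorded, trigger the timeout of view $M.view$ if not yet triggered; when $2f+1$ are recorded, form a TC $tc$ (with $high\_tip$ the reported tip of highest view, ties broken by highest $header.qc.view$, if this view exceeds all reported QC views; otherwise with $high\_qc$ the highest reported QC), Enter($tc$), and ProposeTC($tc$) if $i$ leads $tc.view+1$. (6) On a valid TC $tc$ with $tc.view\ge cur\_view$: Enter($tc$); broadcast $tc$ if no TC and no timeout message was broadcast for $tc.view$; ProposeTC($tc$) if $i$ leads $tc.view+1$. (7) On $\langle\mathsf{ProposalRequest},tc\rangle$ or $\langle\mathsf{NERequest},tc\rangle$ from the leader of $tc.view+1\ge cur\_view$, with $tc$ valid and $tc.high\_tip\neq\bot$: Enter($tc$); for a ProposalRequest, if $i$ has a proposal with $proposal\_id=tc.high\_tip.proposal\_id$,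 send it to that leader; for an NERequest, if $i$ has not voted for a proposal with that $proposal\_id$ and has sent no NE message in view $tc.view+1$, send that leader an NE signature on $(tc.view+1,tc.high\_tip.header.qc.view)$. TERMINOLOGY. Block $B_1$ is the parent of $B_2$ if some proposal $p$ has $p.block=B_1$ and $p.proposal\_id=B_2.qc.proposal\_id$. The height (log position) of a block is its distance from the genesis block under the parent relation; committing a block commits all its ancestors at their heights in the validator's local log. *)

(* Defs.v *)
From Stdlib Require List.
From mathcomp Require Import all_boot all_order all_algebra.
From mathcomp Require Import reals.

Set Implicit Arguments.
Unset Strict Implicit.
Unset Printing Implicit Defensive.

Import Order.TTheory GRing.Theory Num.Theory.

Local Open Scope nat_scope.

(* Procedures and handlers are nondeterministic state transformers, given as
   relations between the state before and the state after. *)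
Section Actions.
Variable S : Type.

Definition action := S -> S -> Prop.

Definition skip : action := fun s s' => s' = s.
Definition update (g : S -> S) : action := fun s s' => s' = g s.
Definition andthen (a b : action) : action :=
  fun s s' => exists s1, a s s1 /\ b s1 s'.
Definition ite (C : S -> Prop) (a b : action) : action :=
  fun s s' => (C s /\ a s s') \/ (~ C s /\ b s s').
Definition when (C : S -> Prop) (a : action) : action := ite C a skip.
Definition choose (T : Type) (C : S -> T -> Prop) (a : T -> action) : action :=
  fun s s' => exists x, C s x /\ a x s s'.
Definition reading (k : S -> action) : action := fun s s' => k s s s'.
Definition each (T : Type) (l : seq T) (a : T -> action) : action :=
  foldr (fun x b => andthen (a x) b) skip l.
Definition given (T : Type) (o : option T) (a : T -> action) : action :=
  if o is Some x then a x else skip.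

End Actions.

Notation "a ;; b" := (andthen a b)
  (at level 100, b at level 200, right associativity).

Notation validator f := 'I_(3 * f + 1).

Section MonadBFT.

Variable R : realType.
Variable f : nat.
Variables hash payload : Type.

Local Notation V := (validator f).

(* A signature is represented by its purported signer, an aggregate signature
   by the set of its purported signers; whether such a claim verifies is
   decided by the predicate [sg] below, from the signatures really made. *)

Record qc := QC {
  qc_view : nat; qc_block : hash; qc_pid : hash; qc_sigs : {set V} }.

(* The genesis block is the only valid one in which [hd_qc] is absent. *)
Record header := Header {
  hd_view : nat; hd_payload : hash; hd_qc : option qc; hd_hash : hash }.

Record block := Block { bl_header : header; bl_payload : payload }.

Record vote := Vote {
  vt_view : nat; vt_block : hash; vt_pid : hash; vt_sig : V }.

Record nec := NEC { nec_view : nat; nec_qc_view : nat; nec_sigs : {set V} }.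

(* [tc_tips_views] and [tc_qcs_views] are meaningful on [tc_sigs] only. *)
Inductive tip := Tip {
  tp_view : nat; tp_pid : hash; tp_header : header; tp_sig : V;
  tp_tc : option tc; tp_nec : option nec }
with tc := TC {
  tc_view : nat;
  tc_tips_views : {ffun V -> option nat};
  tc_high_tip : option tip;
  tc_qcs_views : {ffun V -> nat};
  tc_high_qc : option qc;
  tc_sigs : {set V} }.

Record proposal := Proposal {
  pr_view : nat; pr_pid : hash; pr_block : block; pr_sig : V;
  pr_tc : option tc; pr_nec : option nec }.

Definition tip_of (p : proposal) : tip :=
  Tip (pr_view p) (pr_pid p) (bl_header (pr_block p)) (pr_sig p)
      (pr_tc p) (pr_nec p).

Inductive cert := CertQC of qc | CertTC of tc.

Definition cert_view (c : cert) : nat :=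
  match c with CertQC q => qc_view q | CertTC c' => tc_view c' end.

Record timeout := Timeout {
  to_view : nat; to_tip : option tip; to_tip_vote : option vote;
  to_qc : option qc; to_last_cer : option cert; to_sig : V }.

Inductive message :=
  | MProposal of proposal
  | MVote of vote
  | MQC of qc
  | MTimeout of timeout
  | MTC of tc
  | MProposalRequest of tc
  | MNERequest of tc
  | MNE of nat & nat & V. (* view, view of the high tip's QC, signer *)

Definition hd_qc_view (h : header) : nat := if hd_qc h is Some q then qc_view q else 0.

Definition pr_header (p : proposal) : header := bl_header (pr_block p).

Definition reported_qc_view (M : timeout) : nat :=
  match to_tip M, to_qc M with
  | Some t, _ => hd_qc_view (tp_header t)
  | None, Some q => qc_view q
  | None, None => 0
  end.

Inductive signed_data :=
  | SVote of nat & hash & hash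
  | SProposal of hash
  | STimeout of nat & option nat & nat
  | SNE of nat & nat.

Definition vote_data (x : vote) := SVote (vt_view x) (vt_block x) (vt_pid x).

Definition timeout_data (M : timeout) :=
  STimeout (to_view M) (omap tp_view (to_tip M)) (reported_qc_view M).

(* The signatures of [j] itself that [j] produces when it sends [m]. *)
Definition produces (j : V) (m : message) (d : signed_data) : Prop :=
  match m with
  | MProposal p => pr_sig p = j /\ d = SProposal (pr_pid p)
  | MVote x => vt_sig x = j /\ d = vote_data x
  | MTimeout M =>
      (to_sig M = j /\ d = timeout_data M) \/
      (exists x, [/\ to_tip_vote M = Some x, vt_sig x = j & d = vote_data x])
  | MNE v q k => k = j /\ d = SNE v q
  | MQC _ | MTC _ | MProposalRequest _ | MNERequest _ => False
  end.

Inductive hash_input :=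
  | HPayload of payload
  | HBlock of nat & hash & option qc
  | HProposal of hash & nat.

Variable H : hash_input -> hash.
Variable leader : nat -> V.
Variable genesis_payload : payload.

Definition round_robin : Prop :=
  forall v w, leader v = leader w <-> v = w %[mod 3 * f + 1].

Definition make_block (v : nat) (pl : payload) (q : option qc) : block :=
  let ph := H (HPayload pl) in Block (Header v ph q (H (HBlock v ph q))) pl.

Definition make_proposal (v : nat) (B : block) (i : V)
    (c : option tc) (n : option nec) : proposal :=
  Proposal v (H (HProposal (hd_hash (bl_header B)) v)) B i c n.

Definition make_vote (v : nat) (bh : hash) (i : V) : vote :=
  Vote v bh (H (HProposal bh v)) i.

Definition genesis_block : block := make_block 0 genesis_payload None.
Definition genesis_proposal : proposal :=
  make_proposal 0 genesis_block (leader 0) None None.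
Definition genesis_tip : tip := tip_of genesis_proposal.
Definition genesis_qc : qc :=
  QC 0 (hd_hash (bl_header genesis_block)) (pr_pid genesis_proposal) set0.

Definition hash_consistent (p : proposal) : Prop :=
  [/\ pr_pid p = H (HProposal (hd_hash (pr_header p)) (pr_view p)),
      hd_hash (pr_header p) =
        H (HBlock (hd_view (pr_header p)) (hd_payload (pr_header p))
                  (hd_qc (pr_header p)))
    & hd_payload (pr_header p) = H (HPayload (bl_payload (pr_block p)))].

Definition points_to (q : qc) (p : proposal) : Prop :=
  hash_consistent p /\ pr_pid p = qc_pid q.

Definition parent (B1 B2 : block) : Prop :=
  exists q p, [/\ hd_qc (bl_header B2) = Some q, points_to q p & pr_block p = B1].

Inductive chain : nat -> block -> block -> Prop :=
  | chain0 B : chain 0 B B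
  | chainS n B1 B2 B3 : chain n B1 B2 -> parent B2 B3 -> chain n.+1 B1 B3.

Definition height (B : block) (h : nat) : Prop :=
  chain h genesis_block B /\ forall n, chain n genesis_block B -> h <= n.

Definition fresh (p : proposal) : bool :=
  [|| (hd_qc_view (pr_header p)).+1 == pr_view p,
      isSome (pr_nec p)
    | if pr_tc p is Some c then isSome (tc_high_qc c) else false].

Section Validity.

(* [sg j d]: a signature of [j] on [d] verifies. *)
Variable sg : V -> signed_data -> Prop.

Definition quorum (k : nat) (S : {set V}) (P : V -> Prop) : Prop :=
  #|S| = k /\ forall j, j \in S -> P j.

Definition valid_qc (q : qc) : Prop :=
  q = genesis_qc \/
  (qc_pid q = H (HProposal (qc_block q) (qc_view q)) /\
   quorum (2 * f + 1) (qc_sigs q)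
     (fun j => sg j (SVote (qc_view q) (qc_block q) (qc_pid q)))).

Definition valid_vote (x : vote) : Prop :=
  vt_pid x = H (HProposal (vt_block x) (vt_view x)) /\ sg (vt_sig x) (vote_data x).

Definition valid_nec (n : nec) : Prop :=
  (nec_qc_view n).+1 < nec_view n /\
  quorum (2 * f + 1) (nec_sigs n) (fun j => sg j (SNE (nec_view n) (nec_qc_view n))).

Definition valid_header (h : header) : Prop :=
  h = bl_header genesis_block \/
  (exists q, hd_qc h = Some q /\ valid_qc q) /\
  hd_hash h = H (HBlock (hd_view h) (hd_payload h) (hd_qc h)).

Definition valid_block (B : block) : Prop :=
  valid_header (bl_header B) /\ hd_payload (bl_header B) = H (HPayload (bl_payload B)).

Fixpoint valid_fresh_tip (T : tip) : Prop :=
  T = genesis_tip \/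
  let: Tip v pid h s oc on := T in
  [/\ valid_header h,
      pid = H (HProposal (hd_hash h) v),
      s = leader v /\ sg s (SProposal pid),
      hd_view h = v /\ hd_qc_view h < v
    & if v == (hd_qc_view h).+1 then oc = None /\ on = None
      else match oc with
           | None => False
           | Some c =>
               [/\ valid_tc c, v = (tc_view c).+1
                 & match on with
                   | None => exists q, tc_high_qc c = Some q /\ hd_qc h = Some q
                   | Some n => [/\ valid_nec n, v = nec_view n
                                 & hd_qc_view h = nec_qc_view n]
                   end]
           end]
with valid_tc (c : tc) : Prop :=
  let: TC v tips ht qcs hq ks := c in
  quorum (2 * f + 1) ks (fun j => sg j (STimeout v (tips j) (qcs j))) /\
  match ht, hq with
  | None, Some q =>
      [/\ valid_qc q, qc_view q < v,
          \max_(j in ks) odflt 0 (tips j) <= qc_view q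
        & qc_view q = \max_(j in ks) qcs j]
  | Some t, None =>
      [/\ valid_fresh_tip t,
          tp_view t <= v,
          forall j w, j \in ks -> tips j = Some w -> qcs j < w /\ w <= tp_view t,
          forall j, j \in ks -> tips j = Some (tp_view t) ->
            qcs j <= hd_qc_view (tp_header t)
        & \max_(j in ks) qcs j < tp_view t]
  | _, _ => False
  end.

Definition valid_proposal (p : proposal) : Prop :=
  [/\ valid_block (pr_block p),
      pr_pid p = H (HProposal (hd_hash (pr_header p)) (pr_view p)),
      pr_sig p = leader (pr_view p) /\ sg (pr_sig p) (SProposal (pr_pid p)),
      hd_view (pr_header p) <= pr_view p /\ hd_qc_view (pr_header p) < pr_view p
    & if fresh p then valid_fresh_tip (tip_of p)
      else hd_view (pr_header p) < pr_view p /\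
           exists c t, [/\ pr_tc p = Some c, valid_tc c, pr_view p = (tc_view c).+1,
                           tc_high_tip c = Some t & pr_header p = tp_header t]].

Definition valid_cert (c : cert) : Prop :=
  match c with CertQC q => valid_qc q | CertTC c' => valid_tc c' end.

Definition valid_timeout (M : timeout) : Prop :=
  [/\ exists c, [/\ to_last_cer M = Some c, valid_cert c
                  & (cert_view c).+1 = to_view M],
      sg (to_sig M) (timeout_data M)
    & match to_tip M, to_qc M with
      | Some t, None =>
          (exists x, [/\ to_tip_vote M = Some x, valid_vote x
                       & vt_view x = to_view M]) /\
          valid_fresh_tip t /\ tp_view t <= to_view M
      | None, Some q => valid_qc q /\ qc_view q < to_view M
      | _, _ => False
      end].

End Validity.

Fixpoint tip_qcs (T : tip) : seq qc :=
  let: Tip _ _ h _ oc _ := T in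
  seq_of_opt (hd_qc h) ++ (if oc is Some c then tc_qcs c else [::])
with tc_qcs (c : tc) : seq qc :=
  let: TC _ _ ht _ hq _ := c in
  seq_of_opt hq ++ (if ht is Some t then tip_qcs t else [::]).

Definition message_qcs (m : message) : seq qc :=
  match m with
  | MProposal p => tip_qcs (tip_of p)
  | MQC q => [:: q]
  | MTimeout M =>
      seq_of_opt (to_qc M) ++ oapp tip_qcs [::] (to_tip M) ++
      match to_last_cer M with
      | Some (CertQC q) => [:: q]
      | Some (CertTC c) => tc_qcs c
      | None => [::]
      end
  | MTC c | MProposalRequest c | MNERequest c => tc_qcs c
  | MVote _ | MNE _ _ _ => [::]
  end.

(* The proposals that [q] points to, and those of the ancestors. *)
Inductive behind : qc -> proposal -> Prop :=
  | behind_here q p : points_to q p -> behind q p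
  | behind_next q p q' p' :
      points_to q p -> hd_qc (pr_header p) = Some q' -> behind q' p' -> behind q p'.

Record recovery := Recovery {
  rc_tc : tc; rc_asked : {set V}; rc_next : R }.

(* Sending time, recipient, message. *)
Definition packet : Type := R * V * message.

(* [timer] is the time at which the view timer expires, if it is running;
   [sent] lists all messages sent so far, in order, and also serves as the
   record of what has already been voted for, broadcast, proposed, ... *)
Record state := State {
  cur_view : nat;
  local_tip : tip;
  highest_voted_view : nat;
  last_qc : qc;
  last_tc : option tc;
  votes : seq vote;
  tip_votes : seq vote;
  timeouts : seq timeout;
  ne_sigs : seq (nat * nat * V);
  stored : seq proposal;
  timer : option R;
  recoveries : seq recovery;
  speculated : seq block;
  committed : seq block;
  sent : seq packet }.

Definition enter_with (deadline : R) (c : cert) (s : state) : state :=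
  let: State _ tip hv lq lt vs tvs tos nes st _ rs sp co out := s in
  State (cert_view c).+1 tip hv
    (if c is CertQC q then q else lq) (if c is CertTC c' then Some c' else lt)
    vs tvs tos nes st (Some deadline) rs sp co out.

Definition set_local_tip (t : tip) (s : state) : state :=
  let: State cv _ hv lq lt vs tvs tos nes st tm rs sp co out := s in
  State cv t hv lq lt vs tvs tos nes st tm rs sp co out.

Definition mark_voted_view (s : state) : state :=
  let: State cv tip _ lq lt vs tvs tos nes st tm rs sp co out := s in
  State cv tip cv lq lt vs tvs tos nes st tm rs sp co out.

Definition add_vote (x : vote) (s : state) : state :=
  let: State cv tip hv lq lt vs tvs tos nes st tm rs sp co out := s in
  State cv tip hv lq lt (x :: vs) tvs tos nes st tm rs sp co out.

Definition add_tip_vote (x : vote) (s : state) : state :=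
  let: State cv tip hv lq lt vs tvs tos nes st tm rs sp co out := s in
  State cv tip hv lq lt vs (x :: tvs) tos nes st tm rs sp co out.

Definition add_timeout (M : timeout) (s : state) : state :=
  let: State cv tip hv lq lt vs tvs tos nes st tm rs sp co out := s in
  State cv tip hv lq lt vs tvs (M :: tos) nes st tm rs sp co out.

Definition add_ne (x : nat * nat * V) (s : state) : state :=
  let: State cv tip hv lq lt vs tvs tos nes st tm rs sp co out := s in
  State cv tip hv lq lt vs tvs tos (x :: nes) st tm rs sp co out.

Definition store (l : seq proposal) (s : state) : state :=
  let: State cv tip hv lq lt vs tvs tos nes st tm rs sp co out := s in
  State cv tip hv lq lt vs tvs tos nes (l ++ st) tm rs sp co out.

Definition stop_timer (s : state) : state :=
  let: State cv tip hv lq lt vs tvs tos nes st _ rs sp co out := s in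
  State cv tip hv lq lt vs tvs tos nes st None rs sp co out.

Definition set_recoveries (g : seq recovery -> seq recovery) (s : state) : state :=
  let: State cv tip hv lq lt vs tvs tos nes st tm rs sp co out := s in
  State cv tip hv lq lt vs tvs tos nes st tm (g rs) sp co out.

Definition add_speculated (B : block) (s : state) : state :=
  let: State cv tip hv lq lt vs tvs tos nes st tm rs sp co out := s in
  State cv tip hv lq lt vs tvs tos nes st tm rs (B :: sp) co out.

Definition add_committed (B : block) (s : state) : state :=
  let: State cv tip hv lq lt vs tvs tos nes st tm rs sp co out := s in
  State cv tip hv lq lt vs tvs tos nes st tm rs sp (B :: co) out.

Definition add_sent (x : packet) (s : state) : state :=
  let: State cv tip hv lq lt vs tvs tos nes st tm rs sp co out := s in
  State cv tip hv lq lt vs tvs tos nes st tm rs sp co (rcons out x).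

Definition has_sent (s : state) (P : V -> message -> Prop) : Prop :=
  exists t j m, List.In (t, j, m) (sent s) /\ P j m.

Definition broadcast_done (s : state) (m : message) : Prop :=
  forall j, has_sent s (fun j' m' => j' = j /\ m' = m).

Definition sent_timeout (s : state) (v : nat) : Prop :=
  has_sent s (fun _ m => if m is MTimeout M then to_view M = v else False).

Definition sent_tc (s : state) (v : nat) : Prop :=
  has_sent s (fun _ m => if m is MTC c then tc_view c = v else False).

Definition sent_ne (s : state) (v : nat) : Prop :=
  has_sent s (fun _ m => if m is MNE w _ _ then w = v else False).

Definition has_voted (s : state) (pid : hash) : Prop :=
  has_sent s (fun _ m =>
    match m with
    | MVote x => vt_pid x = pid
    | MTimeout M => if to_tip_vote M is Some x then vt_pid x = pid else False
    | _ => False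
    end).

Variables theta_view theta_interval : R.
Variable kappa : nat.

Section Handlers.

Variable i : V. (* the acting validator *)
Variable now : R.
Variable sg : V -> signed_data -> Prop.

Local Notation act := (action state).

Definition issued (s : state) (v : nat) : Prop :=
  has_sent s (fun _ m =>
    if m is MProposal p then pr_view p = v /\ pr_sig p = i else False).

Definition send (j : V) (m : message) : act := update (add_sent (now, j, m)).

Definition broadcast (m : message) : act := each (enum V) (fun j => send j m).

Definition Enter (c : cert) : act :=
  when (fun s => cur_view s <= cert_view c)
       (update (enter_with (now + theta_view)%R c)).

(* A validator that obtains [q] obtains a proposal [q] points to, provided that
   there is one, and possibly proposals for ancestors. A QC made of tip votes
   may point to a proposal that no leader ever issued. *)
Definition obtain (q : qc) : act :=
  choose (fun s l =>
      (forall p, List.In p l -> valid_proposal sg p /\ behind q p) /\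
      ((exists p, valid_proposal sg p /\ points_to q p) ->
       exists p, List.In p (l ++ stored s) /\ points_to q p))
    (fun l => update (store l)).

Definition resolves (q : qc) (s : state) (p : proposal) : Prop :=
  points_to q p /\
  ((exists p', List.In p' (stored s) /\ points_to q p') -> List.In p (stored s)).

Definition Commit (q : qc) : act :=
  obtain q ;;
  choose (resolves q) (fun par =>
    when (fun _ => fresh par) (update (add_speculated (pr_block par))) ;;
    given (hd_qc (pr_header par)) (fun q' =>
      when (fun _ => qc_view q = (qc_view q').+1)
        (choose (resolves q') (fun gp => update (add_committed (pr_block gp)))))).

(* A leader issues at most one proposal per view. *)
Definition propose (B : state -> block -> Prop) (c : option tc) (n : option nec) : act :=
  when (fun s => ~ issued s (cur_view s))
    (choose B (fun b =>
      reading (fun s => broadcast (MProposal (make_proposal (cur_view s) b i c n))))).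

Definition new_block (q : qc) (s : state) (B : block) : Prop :=
  exists pl, B = make_block (cur_view s) pl (Some q).

Definition ProposeQC (q : qc) : act := propose (new_block q) None None.

Definition repropose (B : block) (c : tc) : act :=
  propose (fun _ b => b = B) (Some c) None.

(* [S] consists of [kappa] further validators, or of all that remain. *)
Definition next_asked (asked S : {set V}) : Prop :=
  [disjoint S & asked] /\ #|S| = minn kappa #|~: asked|.

Definition request_proposal (c : tc) (S : {set V}) : act :=
  each (enum S) (fun j => send j (MProposalRequest c)).

Definition Recover (c : tc) : act :=
  update (set_recoveries (filter (fun r => tc_view c <= tc_view (rc_tc r)))) ;;
  broadcast (MNERequest c) ;;
  choose (fun _ => next_asked set0) (fun S =>
    request_proposal c S ;;
    update (set_recoveries (cons (Recovery c S (now + theta_interval)%R)))).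

Definition available (t : tip) (s : state) (B : block) : Prop :=
  exists p, [/\ List.In p (stored s), pr_block p = B & bl_header B = tp_header t].

Definition ProposeTC (c : tc) : act :=
  match tc_high_qc c, tc_high_tip c with
  | Some q, _ => propose (new_block q) (Some c) None
  | None, Some t =>
      ite (fun s => exists B, available t s B)
        (choose (available t) (fun B => repropose B c))
        (Recover c)
  | None, None => skip (S := state)
  end.

(* Recover([c]) returns and [a] uses the result. The proposal would be for view
   [c.view + 1]; the result is dropped if the validator has left that view. *)
Definition recovered (c : tc) (a : act) : act :=
  update (set_recoveries (filter (fun r => tc_view (rc_tc r) != tc_view c))) ;;
  when (fun s => cur_view s = (tc_view c).+1) a.

Definition BroadcastQC (q : qc) : act :=
  when (fun s => ~ broadcast_done s (MQC q)) (broadcast (MQC q)).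

Definition own_vote (s : state) : vote :=
  make_vote (cur_view s) (hd_hash (tp_header (local_tip s))) i.

Definition formed (l : seq vote) (x : vote) (q : qc) : Prop :=
  exists S, q = QC (vt_view x) (vt_block x) (vt_pid x) S /\
    quorum (2 * f + 1) S
      (fun j => exists y, [/\ List.In y l, vt_sig y = j & vt_pid y = vt_pid x]).

Definition recovers_by (p : proposal) (s : state) (c : tc) : Prop :=
  exists r t, [/\ List.In r (recoveries s), rc_tc r = c,
                  tc_high_tip c = Some t & tp_pid t = pr_pid p].

Definition on_proposal (j : V) (p : proposal) : act :=
  when (fun _ => valid_proposal sg p)
   (update (store [:: p]) ;;
    ite (fun s => exists c, recovers_by p s c)
      (choose (recovers_by p) (fun c => recovered c (repropose (pr_block p) c)))
      (skip (S := state)) ;;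
    when (fun s => j = leader (pr_view p) /\ cur_view s <= pr_view p)
      (given (hd_qc (pr_header p)) (fun q =>
        Enter (if pr_tc p is Some c then CertTC c else CertQC q) ;;
        when (fun _ => (qc_view q).+1 = pr_view p)
          (when (fun _ => i = leader (qc_view q)) (BroadcastQC q) ;;
           send (leader (qc_view q)) (MQC q)) ;;
        Commit q ;;
        when (fun s => highest_voted_view s < pr_view p)
          ((if fresh p then update (set_local_tip (tip_of p))
            else given (obind tc_high_tip (pr_tc p))
                   (fun t => update (set_local_tip t))) ;;
           reading (fun s =>
             send (leader (cur_view s)) (MVote (own_vote s)) ;;
             send (leader (cur_view s).+1) (MVote (own_vote s))) ;;
           update mark_voted_view)))).

Definition on_vote (x : vote) : act :=
  when (fun s => [/\ valid_vote sg x, cur_view s <= vt_view x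
                   & i = leader (vt_view x) \/ i = leader (vt_view x).+1])
   (update (add_vote x) ;;
    ite (fun s => exists q, formed (votes s) x q)
      (choose (fun s => formed (votes s) x) (fun q =>
        Enter (CertQC q) ;; Commit q ;;
        ite (fun _ => i = leader (qc_view q)) (BroadcastQC q) (ProposeQC q)))
      (skip (S := state))).

Definition on_qc (j : V) (q : qc) : act :=
  when (fun s => valid_qc sg q /\ cur_view s <= qc_view q)
   (when (fun _ => j = leader (qc_view q))
      (Enter (CertQC q) ;; Commit q ;; send (leader (qc_view q).+1) (MQC q)) ;;
    when (fun _ => i = leader (qc_view q)) (BroadcastQC q) ;;
    when (fun _ => i = leader (qc_view q).+1)
      (Enter (CertQC q) ;; Commit q ;; ProposeQC q)).

Definition own_timeout (s : state) : timeout :=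
  let v := cur_view s in
  let cer := if (qc_view (last_qc s)).+1 == v then Some (CertQC (last_qc s))
             else omap CertTC (last_tc s) in
  if tp_view (local_tip s) <= qc_view (last_qc s)
  then Timeout v None None (Some (last_qc s)) cer i
  else Timeout v (Some (local_tip s)) (Some (own_vote s)) None cer i.

Definition time_out : act :=
  when (fun s => ~ sent_timeout s (cur_view s))
   (update mark_voted_view ;; update stop_timer ;;
    reading (fun s => broadcast (MTimeout (own_timeout s)))).

Definition recorded (s : state) (v : nat) (j : V) (M : timeout) : Prop :=
  [/\ List.In M (timeouts s), to_view M = v & to_sig M = j].

(* [t] is the reported tip of highest view, ties being broken by the view of
   the header's QC, and its view exceeds all reported QC views. *)
Definition top_tip (S : {set V}) (rep : V -> timeout) (t : tip) : Prop :=
  [/\ exists2 j, j \in S & to_tip (rep j) = Some t,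
      forall j t', j \in S -> to_tip (rep j) = Some t' ->
        tp_view t' < tp_view t \/
        (tp_view t' = tp_view t /\
         hd_qc_view (tp_header t') <= hd_qc_view (tp_header t))
    & forall j q, j \in S -> to_qc (rep j) = Some q -> qc_view q < tp_view t].

Definition top_qc (S : {set V}) (rep : V -> timeout) (q : qc) : Prop :=
  (exists2 j, j \in S & to_qc (rep j) = Some q) /\
  forall j q', j \in S -> to_qc (rep j) = Some q' -> qc_view q' <= qc_view q.

Definition forms_tc (v : nat) (s : state) (c : tc) : Prop :=
  exists rep : V -> timeout,
  [/\ tc_view c = v,
      quorum (2 * f + 1) (tc_sigs c) (fun j => recorded s v j (rep j)),
      forall j, j \in tc_sigs c ->
        tc_tips_views c j = omap tp_view (to_tip (rep j)) /\
        tc_qcs_views c j = reported_qc_view (rep j)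
    & (exists t, [/\ top_tip (tc_sigs c) rep t,
                     tc_high_tip c = Some t & tc_high_qc c = None]) \/
      ((forall t, ~ top_tip (tc_sigs c) rep t) /\
       exists q, [/\ top_qc (tc_sigs c) rep q,
                     tc_high_tip c = None & tc_high_qc c = Some q])].

Definition tip_formed (M : timeout) (s : state) (q : qc) : Prop :=
  exists x, [/\ isSome (to_tip M), to_tip_vote M = Some x & formed (tip_votes s) x q].

Definition on_timeout (M : timeout) : act :=
  when (fun s => valid_timeout sg M /\ cur_view s <= to_view M)
   (given (to_last_cer M) (fun c =>
      (if c is CertTC c' then
         when (fun s => ~ sent_timeout s (tc_view c') /\ ~ sent_tc s (tc_view c'))
           (broadcast (MTC c'))
       else skip (S := state)) ;;
      Enter c ;;
      when (fun s => i = leader (cert_view c).+1 /\ ~ issued s (cert_view c).+1)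
        (match c with CertQC q => ProposeQC q | CertTC c' => ProposeTC c' end) ;;
      (if c is CertQC q then
         when (fun _ => i = leader (qc_view q)) (BroadcastQC q) ;;
         send (leader (qc_view q)) (MQC q) ;;
         send (leader (qc_view q).+1) (MQC q) ;;
         Commit q
       else skip (S := state))) ;;
    (if to_tip M is Some _ then
       given (to_tip_vote M) (fun x => update (add_tip_vote x))
     else skip (S := state)) ;;
    ite (fun s => exists q, tip_formed M s q)
      (choose (tip_formed M) (fun q =>
         Enter (CertQC q) ;; Commit q ;;
         when (fun _ => i = leader (qc_view q).+1) (ProposeQC q)))
      (update (add_timeout M) ;;
       when (fun s => exists S, quorum (f + 1) S
                        (fun j => exists M', recorded s (to_view M) j M'))
         time_out ;;
       when (fun s => exists S, quorum (2 * f + 1) S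
                        (fun j => exists M', recorded s (to_view M) j M'))
         (choose (forms_tc (to_view M)) (fun c =>
            Enter (CertTC c) ;;
            when (fun _ => i = leader (tc_view c).+1) (ProposeTC c))))).

Definition on_tc (c : tc) : act :=
  when (fun s => valid_tc sg c /\ cur_view s <= tc_view c)
   (Enter (CertTC c) ;;
    when (fun s => ~ sent_tc s (tc_view c) /\ ~ sent_timeout s (tc_view c))
      (broadcast (MTC c)) ;;
    when (fun _ => i = leader (tc_view c).+1) (ProposeTC c)).

Definition on_request (j : V) (c : tc) (answer : tip -> act) : act :=
  when (fun s => [/\ valid_tc sg c, j = leader (tc_view c).+1
                   & cur_view s <= (tc_view c).+1])
   (given (tc_high_tip c) (fun t => Enter (CertTC c) ;; answer t)).

Definition on_proposal_request (j : V) (c : tc) : act :=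
  on_request j c (fun t =>
    ite (fun s => exists p, List.In p (stored s) /\ pr_pid p = tp_pid t)
      (choose (fun s p => List.In p (stored s) /\ pr_pid p = tp_pid t)
        (fun p => send j (MProposal p)))
      (skip (S := state))).

Definition on_ne_request (j : V) (c : tc) : act :=
  on_request j c (fun t =>
    when (fun s => ~ has_voted s (tp_pid t) /\ ~ sent_ne s (tc_view c).+1)
      (send j (MNE (tc_view c).+1 (hd_qc_view (tp_header t)) i))).

Definition recovers_with (v q : nat) (s : state) (x : tc * qc * nec) : Prop :=
  let: (c, hq, n) := x in
  exists r t, [/\ List.In r (recoveries s) /\ rc_tc r = c,
                  tc_high_tip c = Some t /\ hd_qc (tp_header t) = Some hq,
                  v = (tc_view c).+1 /\ q = qc_view hq,
                  nec_view n = v /\ nec_qc_view n = q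
                & quorum (2 * f + 1) (nec_sigs n)
                    (fun k => List.In (v, q, k) (ne_sigs s))].

Definition on_ne (v q : nat) (k : V) : act :=
  when (fun _ => sg k (SNE v q))
   (update (add_ne (v, q, k)) ;;
    ite (fun s => exists x, recovers_with v q s x)
      (choose (recovers_with v q) (fun '(c, hq, n) =>
         recovered c (propose (new_block hq) (Some c) (Some n))))
      (skip (S := state))).

(* [j] is the sender of [m]: channels are authenticated. *)
Definition receive (j : V) (m : message) : act :=
  each (message_qcs m) (fun q => when (fun _ => valid_qc sg q) (obtain q)) ;;
  match m with
  | MProposal p => on_proposal j p
  | MVote x => on_vote x
  | MQC q => on_qc j q
  | MTimeout M => on_timeout M
  | MTC c => on_tc c
  | MProposalRequest c => on_proposal_request j c
  | MNERequest c => on_ne_request j c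
  | MNE v q k => on_ne v q k
  end.

Definition ask_further : act :=
  choose (fun s (x : seq recovery * recovery * seq recovery * {set V}) =>
      let: (l1, r, l2, ks) := x in
      [/\ recoveries s = l1 ++ r :: l2, rc_next r = now & next_asked (rc_asked r) ks])
    (fun '(l1, r, l2, ks) =>
       request_proposal (rc_tc r) ks ;;
       update (set_recoveries (fun _ =>
         l1 ++ Recovery (rc_tc r) (rc_asked r :|: ks) (now + theta_interval)%R :: l2))).

Definition start : act :=
  Enter (CertQC genesis_qc) ;;
  when (fun _ => i = leader 1) (ProposeQC genesis_qc).

End Handlers.

Definition blank : state :=
  State 0 genesis_tip 0 genesis_qc None [::] [::] [::] [::] [:: genesis_proposal]
        None [::] [::] [::] [::].

Variable byz : {set V}.

(* [delivered] holds the pairs (sender, position in the sender's [sent]) of the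
   delivered packets. The [local] state of a Byzantine validator is irrelevant. *)
Record config := Config {
  local : V -> state;
  delivered : seq (V * nat) }.

(* Unforgeability: a signature of a correct validator verifies only if this
   validator made it; those of Byzantine validators always verify. *)
Definition verifies (c : config) (j : V) (d : signed_data) : Prop :=
  j \in byz \/ has_sent (local c j) (fun _ m => produces j m d).

Inductive event :=
  | Deliver of V & nat              (* sender, position in its [sent] *)
  | Byzantine of V & V & message    (* sender, recipient, message *)
  | TimerExpires of V
  | AskFurther of V
  | Idle.

Definition steps (i : V) (a : action state) (c c' : config) : Prop :=
  [/\ i \notin byz, a (local c i) (local c' i)
    & forall j, j != i -> local c' j = local c j].

(* No timer of a correct validator is overdue. *)
Definition timely (now : R) (c : config) : Prop :=
  forall i, i \notin byz ->
    (forall d, timer (local c i) = Some d -> (now <= d)%R) /\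
    (forall r, List.In r (recoveries (local c i)) -> rc_asked r != setT ->
       (now <= rc_next r)%R).

Definition step (now : R) (c : config) (e : event) (c' : config) : Prop :=
  timely now c /\
  match e with
  | Deliver j k =>
      exists t i m,
        [/\ j \notin byz, onth (sent (local c j)) k = Some (t, i, m),
            (j, k) \notin delivered c,
            steps i (receive i now (verifies c) j m) c c'
          & delivered c' = (j, k) :: delivered c]
  | Byzantine j i m =>
      [/\ j \in byz, steps i (receive i now (verifies c) j m) c c'
        & delivered c' = delivered c]
  | TimerExpires i =>
      [/\ timer (local c i) = Some now, steps i (time_out i now) c c'
        & delivered c' = delivered c]
  | AskFurther i =>
      steps i (ask_further now) c c' /\ delivered c' = delivered c
  | Idle => (forall j, local c' j = local c j) /\ delivered c' = delivered c
  end.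

Variable delta : R.

(* [run k] is the configuration before event [ev k], which happens at [tm k]. *)
Record execution (run : nat -> config) (ev : nat -> event) (tm : nat -> R) : Prop :=
  Execution {
    exec_init :
      delivered (run 0) = [::] /\
      forall i, i \notin byz -> start i 0%R blank (local (run 0) i);
    exec_step : forall k, step (tm k) (run k) (ev k) (run k.+1);
    exec_time : (0 <= tm 0)%R /\ forall k, (tm k <= tm k.+1)%R;
    exec_progress : forall T : R, exists k, (T <= tm k)%R;
    exec_synchrony :
      exists GST : R, forall k i j n t m,
        i \notin byz -> j \notin byz ->
        onth (sent (local (run k) i)) n = Some (t, j, m) ->
        exists l, ev l = Deliver i n /\ (tm l <= Num.max t GST + delta)%R }.

(* [s] has [B] at height [h] of its log. Speculative commits do not count. *)
Definition in_log (s : state) (h : nat) (B : block) : Prop :=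
  height B h /\ exists B' n, List.In B' (committed s) /\ chain n B B'.

End MonadBFT.

(* Main.v *)
(* A correct validator casts a vote or a timeout in view w for its local tip, and
   that tip either is the one it had in an earlier such view w0 or was adopted
   from a valid proposal of a view in (w0, w]; in particular it votes for one
   block per view, so a view certifies at most one block.
   Let B be committed: B is certified in view v and its child in view v + 1.
   By induction on w > v, every valid TC of view w carries a high QC of view >= v
   or a high tip whose header has a QC of view >= v. For, one of its signers is a
   correct validator that voted for the child in view v + 1; the tip it reports
   is still that child, or was adopted in a later view, where the induction
   hypothesis bounds the QC view through the TC of the proposal (or through the
   TC seen by a correct signer of its NEC); and the high QC or high tip dominates
   this report. A second quorum intersection shows that a block certified in a
   view > v has a QC of view >= v in its header, hence descends from B. *)
Require Import Defs.
From mathcomp Require Import all_boot all_order all_algebra.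
From mathcomp Require Import reals.
From mathcomp Require Import zify.
From Stdlib Require List.

Set Implicit Arguments.
Unset Strict Implicit.
Unset Printing Implicit Defensive.

Local Open Scope nat_scope.

(** * Partial-correctness triples for nondeterministic actions *)

Section HoareLogic.
Variable S : Type.
Implicit Types (P Q : S -> Prop) (a b : action S).

Definition hoare P a Q := forall s s', P s -> a s s' -> Q s'.

Lemma hoare_skip P : hoare P (@skip S) P.
Proof. by move=> s s' Ps ->. Qed.

Lemma hoare_update P Q g : (forall s, P s -> Q (g s)) -> hoare P (update g) Q.
Proof. by move=> PQ s s' Ps ->; apply: PQ. Qed.

Lemma hoare_seq P Q T a b : hoare P a Q -> hoare Q b T -> hoare P (a ;; b) T.
Proof. by move=> ha hb s s' Ps [s1 [/(ha _ _ Ps) Qs1 /(hb _ _ Qs1)]]. Qed.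

Lemma hoare_ite P Q C a b :
  hoare (fun s => P s /\ C s) a Q -> hoare P b Q -> hoare P (ite C a b) Q.
Proof.
by move=> ha hb s s' Ps [[Cs /ha]|[_ /hb]]; [apply; split | apply].
Qed.

Lemma hoare_when P C a : hoare (fun s => P s /\ C s) a P -> hoare P (when C a) P.
Proof. by move=> ha; apply: hoare_ite ha (@hoare_skip P). Qed.

Lemma hoare_choose (T : Type) P Q (C : S -> T -> Prop) (a : T -> action S) :
  (forall x, hoare (fun s => P s /\ C s x) (a x) Q) -> hoare P (Defs.choose C a) Q.
Proof. by move=> ha s s' Ps [x [Cs /ha]]; apply; split. Qed.

Lemma hoare_given (T : Type) P (o : option T) (a : T -> action S) :
  (forall x, o = Some x -> hoare P (a x) P) -> hoare P (given o a) P.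
Proof. by case: o => [x /(_ x erefl)|_] //; apply: hoare_skip. Qed.

(** For a guarded action that ends a handler: the body may lose part of the precondition, and the
    skipped branch only has to weaken it. *)
Lemma hoare_when_post P Q C a :
  (forall s, P s -> Q s) -> hoare (fun s => P s /\ C s) a Q -> hoare P (when C a) Q.
Proof. by move=> PQ ha; apply: hoare_ite ha _ => s s' /PQ Qs ->. Qed.

Lemma hoare_given_post (T : Type) P Q (o : option T) (a : T -> action S) :
  (forall s, P s -> Q s) -> (forall x, o = Some x -> hoare P (a x) Q) ->
  hoare P (given o a) Q.
Proof.
by move=> PQ; case: o => [x /(_ x erefl)|_] //= s s' /PQ Qs ->.
Qed.

Lemma hoare_each (T : Type) P (l : seq T) (a : T -> action S) :
  (forall x, hoare P (a x) P) -> hoare P (each l a) P.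
Proof.
move=> ha; elim: l => [|x l IHl] /=; first exact: hoare_skip.
exact: hoare_seq (ha x) IHl.
Qed.

Lemma hoare_strengthen P P' Q a :
  (forall s, P' s -> P s) -> hoare P a Q -> hoare P' a Q.
Proof. by move=> PP' ha s s' /PP'; apply: ha. Qed.

Lemma hoare_drop P C Q a : hoare P a Q -> hoare (fun s => P s /\ C s) a Q.
Proof. by apply: hoare_strengthen => s []. Qed.

End HoareLogic.

(** * Effect of the handlers on a local state *)

Section Safety.
Variables (R : realType) (f : nat) (hash payload : Type).
Variable H : hash_input f hash payload -> hash.
Variable leader : nat -> validator f.
Variable genesis_payload : payload.

Local Notation V := (validator f).
Local Notation qc := (qc f hash).
Local Notation tc := (tc f hash).
Local Notation tip := (tip f hash).
Local Notation vote := (vote f hash).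
Local Notation block := (block f hash payload).
Local Notation proposal := (proposal f hash payload).
Local Notation message := (message f hash payload).
Local Notation packet := (packet R f hash payload).
Local Notation state := (state R f hash payload).
Local Notation signing := (V -> signed_data hash -> Prop).
Local Notation genesis_qc := (genesis_qc H leader genesis_payload).
Local Notation genesis_tip := (genesis_tip H leader genesis_payload).
Local Notation genesis_block := (genesis_block H genesis_payload).
Local Notation valid_qc := (valid_qc H leader genesis_payload).
Local Notation valid_nec := (@valid_nec f hash).
Local Notation valid_header := (valid_header H leader genesis_payload).
Local Notation valid_block := (valid_block H leader genesis_payload).
Local Notation valid_fresh_tip := (valid_fresh_tip H leader genesis_payload).
Local Notation valid_tc := (valid_tc H leader genesis_payload).
Local Notation valid_proposal := (valid_proposal H leader genesis_payload).
Local Notation valid_vote := (valid_vote H).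
Local Notation points_to := (points_to H).

(** * Validity is monotone in the set of verifying signatures *)

Section Monotonicity.
Variables sg sg' : signing.
Hypothesis sg_le : forall j d, sg j d -> sg' j d.

Lemma quorum_mono k (A : {set V}) (P P' : V -> Prop) :
  (forall j, P j -> P' j) -> quorum k A P -> quorum k A P'.
Proof. by move=> PP' [cA PA]; split=> // j /PA/PP'. Qed.

Lemma valid_qc_mono q : valid_qc sg q -> valid_qc sg' q.
Proof.
case=> [->|[Eq Q]]; [by left | right; split=> //].
by apply: quorum_mono Q => j /sg_le.
Qed.

Lemma valid_vote_mono x : valid_vote sg x -> valid_vote sg' x.
Proof. by case=> Ex /sg_le. Qed.

Lemma valid_nec_mono n : valid_nec sg n -> valid_nec sg' n.
Proof. by case=> lt_n Q; split=> //; apply: quorum_mono Q => j /sg_le. Qed.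

Lemma valid_header_mono h : valid_header sg h -> valid_header sg' h.
Proof.
case=> [->|[[q [Eq /valid_qc_mono Vq]] Eh]]; [by left | right].
by split=> //; exists q.
Qed.

Lemma valid_block_mono B : valid_block sg B -> valid_block sg' B.
Proof. by case=> /valid_header_mono. Qed.

(** Tips and TCs contain one another, so both statements are proved by a single mutual structural
    recursion. *)
Fixpoint valid_fresh_tip_mono T {struct T} :
  valid_fresh_tip sg T -> valid_fresh_tip sg' T
with valid_tc_mono c {struct c} : valid_tc sg c -> valid_tc sg' c.
Proof.
  case: T => v pid h s oc on /= [->|Vt]; [by left | right].
  case: Vt => [/valid_header_mono Vh Epid [Es /sg_le Ss] hv Hc]; split=> //.
  case: eqP Hc => // _; case: oc => [c|] //= [Vc Ec Hn].
  split=> //; first exact: valid_tc_mono.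
  by case: on Hn => [n [/valid_nec_mono]|].
case: c => v tips ht qcs hq ks /= [Q Hc]; split.
  by apply: quorum_mono Q => j /sg_le.
case: ht Hc => [t|]; case: hq => [q|] //=.
  by case=> Vt; split=> //; apply: valid_fresh_tip_mono.
by case=> /valid_qc_mono.
Qed.

End Monotonicity.

Lemma valid_proposal_mono (sg sg' : signing) (p : proposal) :
  (forall j d, sg j d -> sg' j d) -> valid_proposal sg p -> valid_proposal sg' p.
Proof.
move=> sg_le [Vb Ep [Es Ss] hv Hp]; split=> //.
- exact: valid_block_mono Vb.
- by split=> //; apply: sg_le.
- case: ifP Hp => _; first exact: valid_fresh_tip_mono.
  case=> lt_p [c [t [Ec Vc ? ? ?]]]; split=> //; exists c, t; split=> //.
  exact: valid_tc_mono Vc.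
Qed.

(** * Actions without influence on safety *)

Record frame (s s' : state) : Prop := Frame {
  frame_cur_view : cur_view s' = cur_view s;
  frame_local_tip : local_tip s' = local_tip s;
  frame_voted_view : highest_voted_view s' = highest_voted_view s;
  frame_votes : votes s' = votes s;
  frame_tip_votes : tip_votes s' = tip_votes s;
  frame_committed : committed s' = committed s;
  frame_old_sent : forall x, List.In x (sent s) -> List.In x (sent s');
  frame_new_sent : forall t j m, List.In (t, j, m) (sent s') ->
    List.In (t, j, m) (sent s) \/
    match m with MVote _ | MTimeout _ | MNE _ _ _ => False | _ => True end }.

Lemma frame_refl s : frame s s.
Proof. by split=> // t j m; left. Qed.

Lemma frame_trans s1 s2 s3 : frame s1 s2 -> frame s2 s3 -> frame s1 s3.
Proof.
case=> e1 e2 e3 e4 e5 e6 o n [e1' e2' e3' e4' e5' e6' o' n']; split; try congruence.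
  by move=> x /o/o'.
by move=> t j m /n' [/n|]; [|right].
Qed.

(** Storing, proposing, requesting and forwarding certificates are quiet. What remains for each
    handler is changing the view or the tip, recording votes, committing, and sending votes,
    timeouts or NE messages. *)
Definition quiet (a : action state) := forall s s', a s s' -> frame s s'.

Lemma quiet_skip : quiet (@skip state).
Proof. by move=> s s' ->; apply: frame_refl. Qed.

Lemma quiet_seq a b : quiet a -> quiet b -> quiet (a ;; b).
Proof. by move=> qa qb s s' [s1 [/qa h1 /qb]]; apply: frame_trans h1. Qed.

Lemma quiet_ite C a b : quiet a -> quiet b -> quiet (ite C a b).
Proof. by move=> qa qb s s' [[_ /qa]|[_ /qb]]. Qed.

Lemma quiet_when C a : quiet a -> quiet (when C a).
Proof. by move=> qa; apply: quiet_ite qa quiet_skip. Qed.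

Lemma quiet_choose (T : Type) (C : state -> T -> Prop) a :
  (forall x, quiet (a x)) -> quiet (Defs.choose C a).
Proof. by move=> qa s s' [x [_ /qa]]. Qed.

Lemma quiet_reading (k : state -> action state) :
  (forall s, quiet (k s)) -> quiet (reading k).
Proof. by move=> qk s s' /qk. Qed.

Lemma quiet_each (T : Type) (l : seq T) (a : T -> action state) :
  (forall x, quiet (a x)) -> quiet (each l a).
Proof.
by move=> qa; elim: l => [|x l IHl] /=; [apply: quiet_skip | apply: quiet_seq].
Qed.

Lemma quiet_given (T : Type) (o : option T) (a : T -> action state) :
  (forall x, quiet (a x)) -> quiet (given o a).
Proof. by move=> qa; case: o => [x|] /=; [apply: qa | apply: quiet_skip]. Qed.

Lemma quiet_store l : quiet (update (Defs.store l)).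
Proof. by move=> s s' ->; case: s => *; split=> // t j m; left. Qed.

Lemma quiet_set_recoveries g : quiet (update (set_recoveries g)).
Proof. by move=> s s' ->; case: s => *; split=> // t j m; left. Qed.

Lemma quiet_add_speculated B : quiet (update (add_speculated B)).
Proof. by move=> s s' ->; case: s => *; split=> // t j m; left. Qed.

Lemma sent_add_sent x (s : state) : sent (add_sent x s) = sent s ++ [:: x].
Proof. by case: s => * /=; rewrite cats1. Qed.

Lemma in_add_sent x y (s : state) :
  List.In y (sent (add_sent x s)) <-> List.In y (sent s) \/ x = y.
Proof.
rewrite sent_add_sent; split=> [/(List.in_app_or (sent s) [:: x])|].
  by case=> [|[|[]]]; [left | right].
move=> yP; apply: (List.in_or_app (sent s) [:: x]).
by case: yP => [|->]; [left | right; left].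
Qed.

Lemma quiet_send now j m :
  match m with MVote _ | MTimeout _ | MNE _ _ _ => False | _ => True end ->
  quiet (send (R := R) now j m).
Proof.
move=> qm s s' ->; split; try by case: s.
  by move=> x xs; apply/in_add_sent; left.
by move=> t k m' /in_add_sent [|[_ _ <-]]; [left | right].
Qed.

Ltac quiet_step := first
  [ exact: quiet_skip | exact: quiet_store | exact: quiet_set_recoveries
  | exact: quiet_add_speculated
  | apply: quiet_send; exact: I | apply: quiet_seq | apply: quiet_when
  | apply: quiet_ite | apply: quiet_choose => ? | apply: quiet_reading => ?
  | apply: quiet_each => ? | apply: quiet_given => ? ].

Lemma quiet_obtain sg q : quiet (obtain (R := R) H leader genesis_payload sg q).
Proof. by rewrite /obtain; repeat quiet_step. Qed.

Lemma quiet_propose i now B c n : quiet (propose (R := R) H i now B c n).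
Proof. by rewrite /propose /broadcast; repeat quiet_step. Qed.

Lemma quiet_BroadcastQC now q : quiet (BroadcastQC (R := R) now q).
Proof. by rewrite /BroadcastQC /broadcast; repeat quiet_step. Qed.

Lemma quiet_ProposeTC theta_interval kappa i now c :
  quiet (ProposeTC (R := R) H theta_interval kappa i now c).
Proof.
rewrite /ProposeTC /Recover /broadcast /request_proposal.
case: tc_high_qc => [q|]; first exact: quiet_propose.
case: tc_high_tip => [t|]; repeat (quiet_step || apply: quiet_propose).
Qed.

Lemma quiet_recovered c a : quiet a -> quiet (recovered (R := R) c a).
Proof. by move=> qa; rewrite /recovered; repeat quiet_step. Qed.

Lemma quiet_ask_further theta_interval kappa now :
  quiet (ask_further (R := R) theta_interval kappa now).
Proof.
rewrite /ask_further /request_proposal.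
by apply: quiet_choose => -[[[l1 r] l2] ks]; repeat quiet_step.
Qed.

(** * Invariant of a correct validator *)

Section Invariant.
Variables (i : V) (sg : signing) (old : seq packet).

Definition adoptable (x : nat) (T : tip) : Prop :=
  exists p, [/\ valid_proposal sg p, pr_view p = x
              & (if fresh p then Some (tip_of p)
                 else obind (@tc_high_tip f hash) (pr_tc p)) = Some T].

Definition tip_hash (T : tip) : hash := hd_hash (tp_header T).

Definition two_chain (q : qc) (q' : qc) : Prop :=
  exists par, [/\ valid_qc sg q, points_to q par, hd_qc (pr_header par) = Some q'
                & qc_view q = (qc_view q').+1].

Definition committable (B : block) : Prop :=
  exists q q' gp, [/\ two_chain q q', points_to q' gp & B = pr_block gp].

(* [ballot w T]: the validator voted or timed out in view [w], its local tip
   being [T]. *)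
Implicit Type ballot : nat -> tip -> Prop.

Definition vote_backed ballot (x : vote) : Prop :=
  exists2 T, ballot (vt_view x) T & vt_block x = tip_hash T.

(** A timeout that reports a QC hides the local tip, but bounds its view by that of the QC. An NE
    message shows that its sender saw a valid TC of the preceding view whose high tip has the stated
    QC view. *)
Definition backed ballot (m : message) : Prop :=
  match m with
  | MVote x => vote_backed ballot x
  | MTimeout M =>
      (forall x, to_tip_vote M = Some x -> vote_backed ballot x) /\
      (exists2 T, ballot (to_view M) T &
         to_tip M = Some T \/
         to_tip M = None /\ tp_view T <= reported_qc_view M)
  | MNE w u _ =>
      exists c t, [/\ valid_tc sg c, w = (tc_view c).+1, tc_high_tip c = Some t
                    & u = hd_qc_view (tp_header t)]
  | _ => True
  end.

(** [ballot_later] is what safety uses; for [w0 = w] its interval is empty, so a view has only one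
    tip. [ballot_tip] relates past ballots to the present tip, which keeps [ballot_later] true when
    a new ballot is added. *)
Record ballots_ok ballot (s : state) : Prop := BallotsOk {
  ballot_tip : forall w T, ballot w T ->
    [/\ 0 < w <= highest_voted_view s, tp_view T <= w, valid_fresh_tip sg T
      & T = local_tip s \/
        exists2 x, w < x <= highest_voted_view s & adoptable x (local_tip s)];
  ballot_later : forall w0 T0 w T, ballot w0 T0 -> ballot w T -> w0 <= w ->
    T = T0 \/ exists2 x, w0 < x <= w & adoptable x T;
  sent_backed : forall t j m, List.In (t, j, m) (sent s) -> backed ballot m }.

(* [old] is arbitrary; taking for it the messages sent at an earlier time shows
   that messages sent are never forgotten. *)
Record inv (s : state) : Prop := Inv {
  inv_view : 0 < cur_view s;
  inv_voted_view : highest_voted_view s <= cur_view s;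
  inv_tip : valid_fresh_tip sg (local_tip s);
  inv_tip_view : tp_view (local_tip s) <= cur_view s;
  inv_votes : forall x, List.In x (votes s) -> valid_vote sg x;
  inv_tip_votes : forall x, List.In x (tip_votes s) -> valid_vote sg x;
  inv_committed : forall B, List.In B (committed s) -> committable B;
  inv_old : forall x, List.In x old -> List.In x (sent s);
  inv_ballots : exists ballot, ballots_ok ballot s }.

Lemma vote_backed_mono ballot ballot' x :
  (forall w T, ballot w T -> ballot' w T) ->
  vote_backed ballot x -> vote_backed ballot' x.
Proof. by move=> le_b [T /le_b bT eT]; exists T. Qed.

Lemma backed_mono ballot ballot' m :
  (forall w T, ballot w T -> ballot' w T) -> backed ballot m -> backed ballot' m.
Proof.
move=> le_b; case: m => //= [x|M]; first exact: vote_backed_mono.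
case=> xP [T /le_b bT rT]; split; last by exists T.
by move=> x /xP; apply: vote_backed_mono.
Qed.

Lemma inv_frame s s' : frame s s' -> inv s -> inv s'.
Proof.
case=> e1 e2 e3 e4 e5 e6 o n [h1 h2 h3 h4 h5 h6 h7 h8 [b [b1 b2 b3]]].
split; rewrite ?e1 ?e2 ?e3 ?e4 ?e5 ?e6 //; first by move=> x /h8/o.
exists b; split; rewrite ?e2 ?e3 // => t j m /n [/b3 //|].
by case: m.
Qed.

(** A vote is cast for [cur_view], not for the view of the proposal; pinning the view between
    [Enter] and the vote identifies the two. *)
Definition inv_at n (s : state) := inv s /\ cur_view s = n.

Lemma hoare_quiet a : quiet a -> hoare inv a inv.
Proof. by move=> qa s s' Is /qa/inv_frame; apply. Qed.

Lemma hoare_at_quiet n a : quiet a -> hoare (inv_at n) a (inv_at n).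
Proof.
move=> qa s s' [Is <-] /qa fr; split; first exact: inv_frame fr Is.
exact: frame_cur_view fr.
Qed.

Lemma hoare_inv_at a : (forall n, hoare (inv_at n) a (inv_at n)) -> hoare inv a inv.
Proof. by move=> ha s s' Is /(ha (cur_view s) _ _ (conj Is erefl)) []. Qed.

Lemma hoare_Enter theta_view now c :
  hoare inv (Enter (R := R) (payload := payload) theta_view now c) inv.
Proof.
apply: hoare_when; apply: hoare_update => s [[]].
case: s => /= cv tip hv lq lt vs tvs tos nes st tm rs sp co out.
move=> h1 h2 h3 h4 h5 h6 h7 h8 [b [b1 b2 b3]] le_c.
split=> //=.
- by apply: leq_trans (leqW le_c).
- by apply: leq_trans (leqW le_c).
- by exists b.
Qed.

Lemma hoare_Enter_at theta_view now c n :
  cert_view c = n ->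
  hoare (fun s => inv s /\ cur_view s <= n.+1)
    (Enter (R := R) (payload := payload) theta_view now c) (inv_at n.+1).
Proof.
move=> <- s s' [Is le_s] Ess'; split; first exact: hoare_Enter Is Ess'.
case: Ess' => [[_ ->]|[/negP]]; first by case: {Is le_s} s.
(* If [Enter] does nothing, the view already exceeds that of the certificate, so by the precondition
   it is exactly the next one. *)
by rewrite -ltnNge => lt_s ->; apply/eqP; rewrite eqn_leq le_s.
Qed.

Lemma hoare_Commit sg' q n : valid_qc sg q ->
  hoare (inv_at n) (Commit (R := R) H leader genesis_payload sg' q) (inv_at n).
Proof.
move=> Vq; apply: hoare_seq (hoare_at_quiet (@quiet_obtain _ _)) _.
apply: hoare_choose => par.
move=> s s' [Is [par_q _]]; move: s s' Is; apply: hoare_seq.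
  by apply: hoare_at_quiet; repeat quiet_step.
apply: hoare_given => q' Eq'; apply: hoare_when.
move=> s s' [Is Eq]; move: s s' Is; apply: hoare_choose => gp.
move=> s s' [Is [gp_q _]]; move: s s' Is; apply: hoare_update.
case=> cv tip hv lq lt vs tvs tos nes st tm rs sp co out.
case=> -[/= h1 h2 h3 h4 h5 h6 h7 h8 [b [b1 b2 b3]]] Ecv.
split=> //; split=> //=; last by exists b.
move=> B [<-|/h7 //]; exists q, q', gp; split=> //.
by exists par; split.
Qed.

Lemma hoare_Commit_inv sg' q : valid_qc sg q ->
  hoare inv (Commit (R := R) H leader genesis_payload sg' q) inv.
Proof. by move=> Vq; apply: hoare_inv_at => n; apply: hoare_Commit. Qed.

(** [inv] hides the ballot under an existential; it is carried explicitly here so that one ballot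
    serves all sends of a broadcast. *)
Lemma hoare_send_backed ballot now j m :
  backed ballot m ->
  hoare (fun s => inv s /\ ballots_ok ballot s) (send (R := R) now j m)
        (fun s => inv s /\ ballots_ok ballot s).
Proof.
move=> Bm; apply: hoare_update => s [Is Bs].
have [Et Eh] : local_tip (add_sent (now, j, m) s) = local_tip s /\
    highest_voted_view (add_sent (now, j, m) s) = highest_voted_view s.
  by case: (s).
have Bs' : ballots_ok ballot (add_sent (now, j, m) s).
  case: Bs => b1 b2 b3; split; rewrite ?Et ?Eh //.
  by move=> t k m' /in_add_sent [/b3 //|[_ _ <-]].
split=> //; case: Is => h1 h2 h3 h4 h5 h6 h7 h8 _.
split; rewrite ?Et ?Eh //; try by case: (s) h1 h2 h4 h5 h6 h7.
  by move=> x /h8 xs; apply/in_add_sent; left.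
by exists ballot.
Qed.

Lemma ballots_ok_mark (s : state) ballot :
  inv s -> ballots_ok ballot s -> ballots_ok ballot (mark_voted_view s).
Proof.
case: s => cv tip hv lq lt vs tvs tos nes st tm rs sp co out /=.
case=> /= h1 h2 h3 h4 h5 h6 h7 h8 _ [/= b1 b2 b3]; split=> //=.
move=> w T /b1 [/andP[w0 le_w] ? ? bT]; rewrite w0 (leq_trans le_w) //; split=> //.
case: bT => [|[x /andP[lt_x le_x] ?]]; [by left | right; exists x => //].
by rewrite lt_x (leq_trans le_x).
Qed.

Lemma inv_mark (s : state) : inv s -> inv (mark_voted_view s).
Proof.
move=> Is; have [b Bs] := inv_ballots Is; have := ballots_ok_mark Is Bs.
case: s Is Bs => cv tip hv lq lt vs tvs tos nes st tm rs sp co out.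
by case=> /= h1 h2 h3 h4 h5 h6 h7 h8 _ _ Bs; split=> //; exists b.
Qed.

(** The new ballot is the latest one, so comparing an older ballot with it is the content of
    [ballot_tip]. Timing out after voting in the same view repeats the same tip. *)
Lemma ballots_ok_cast (s : state) ballot :
  inv s -> highest_voted_view s = cur_view s -> ballots_ok ballot s ->
  ballots_ok (fun w T => ballot w T \/ (w = cur_view s /\ T = local_tip s)) s.
Proof.
move=> Is Ehv [b1 b2 b3]; split.
- move=> w T [/b1 //|[-> ->]].
  split; [|exact: inv_tip_view|exact: inv_tip|by left].
  by rewrite Ehv leqnn (inv_view Is).
- move=> w0 T0 w T [b0|[-> ->]] [bT|[-> ->]] le_w.
  + exact: b2 le_w.
  + by have [_ _ _] := b1 _ _ b0; rewrite Ehv => -[->|?]; [left | right].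
  (* A ballot in the highest voted view leaves no room for a later adoption, so its tip is still the
     local one. *)
  + have [/andP[_ le_w'] _ _ [->|[x /andP[lt_x le_x]]]] := b1 _ _ bT; first by left.
    by move: (leq_ltn_trans le_w (leq_trans lt_x le_x)); rewrite Ehv ltnn.
  + by left.
- by move=> t j m /b3; apply: backed_mono => w T; left.
Qed.

Lemma hoare_time_out now : hoare inv (time_out (R := R) H i now) inv.
Proof.
apply: hoare_when => s s' [Is _] [_ [-> [_ [-> ]]]].
have := inv_mark Is; have [b Bs] := inv_ballots Is.
have {Bs} := ballots_ok_mark Is Bs.
have : highest_voted_view (mark_voted_view s) = cur_view (mark_voted_view s).
  by case: s {Is}.
move: (mark_voted_view s) => {Is}s Ehv Bs Is.
have {Is Bs Ehv}[Is Bs Ehv] : [/\ inv (stop_timer s), ballots_ok b (stop_timer s)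
    & highest_voted_view (stop_timer s) = cur_view (stop_timer s)].
  case: s Is Bs Ehv => cv tip hv lq lt vs tvs tos nes st tm rs sp co out.
  case=> /= h1 h2 h3 h4 h5 h6 h7 h8 [b0 [c1 c2 c3]] [/= b1 b2 b3] ?.
  by split=> //; split=> //=; exists b0; split.
move: (stop_timer s) Is Bs Ehv => {}s Is Bs Ehv.
have {}Bs := ballots_ok_cast Is Ehv Bs.
rewrite /reading /broadcast.
set b' := (X in ballots_ok X _) in Bs.
suff Bm : backed b' (MTimeout payload (own_timeout H i s)).
  have send_m j := @hoare_send_backed b' now j _ Bm.
  by move=> Es; have [] := hoare_each send_m (conj Is Bs) Es.
have bT : b' (cur_view s) (local_tip s) by right.
(* The test that chooses between QC and tip is the inequality that [backed] demands of a reported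
   QC. *)
rewrite /own_timeout; case: ifP => [le_t|_] /=; split=> //.
- by exists (local_tip s) => //; right; split.
- by move=> x [<-]; exists (local_tip s).
- by exists (local_tip s) => //; left.
Qed.

Lemma hoare_NE now j w u k c t :
  valid_tc sg c -> w = (tc_view c).+1 -> tc_high_tip c = Some t ->
  u = hd_qc_view (tp_header t) ->
  hoare inv (send (R := R) now j (MNE hash payload w u k)) inv.
Proof.
move=> Vc Ew Et Eu s s' Is; have [b Bs] := inv_ballots Is.
have Bm : backed b (MNE hash payload w u k) by exists c, t.
by move=> Es; have [] := hoare_send_backed Bm (conj Is Bs) Es.
Qed.

(** All earlier ballots have views below [x], so for each of them the new local tip counts as
    adopted later, in view [x]. *)
Lemma inv_vote now s T x :
  inv s -> cur_view s = x -> highest_voted_view s < x ->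
  adoptable x T -> valid_fresh_tip sg T -> tp_view T <= x ->
  hoare (fun s1 => s1 = set_local_tip T s)
   (reading (fun s1 =>
      send now (leader (cur_view s1)) (MVote payload (own_vote H i s1)) ;;
      send now (leader (cur_view s1).+1) (MVote payload (own_vote H i s1))) ;;
    update (@mark_voted_view R f hash payload)) inv.
Proof.
move=> Is Ecv lt_hv aT vT le_T s1 s' -> [_ [[_ [-> ->]] ->]] {s1 s'}.
set s1 := set_local_tip T s.
set m := own_vote H i s1.
set j := leader (cur_view s1); set j' := leader (cur_view s1).+1.
(* Marking the view is moved before the sends, so that the ballot exists when the votes have to be
   backed by it. *)
have -> : mark_voted_view (add_sent (now, j', MVote payload m)
    (add_sent (now, j, MVote payload m) s1)) =
  add_sent (now, j', MVote payload m)
    (add_sent (now, j, MVote payload m) (mark_voted_view s1)).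
  by case: (s1).
have [b Bs] := inv_ballots Is.
have {Bs} Bs1 : ballots_ok b (mark_voted_view s1).
  move: (inv_voted_view Is); rewrite /s1.
  case: (s) Bs Ecv lt_hv => cv tip hv lq lt vs tvs tos nes st tm rs sp co out.
  case=> /= b1 b2 b3 Ecv lt_hv le_hv; split=> //=.
  move=> w T' /b1 [/andP[w0 le_w] le_T' vT' _]; split=> //.
    by rewrite w0 (leq_trans le_w).
  by right; exists x => //; rewrite Ecv leqnn andbT (leq_ltn_trans le_w).
have Is1 : inv (mark_voted_view s1).
  move: Bs1 Is Ecv lt_hv; rewrite /s1.
  case: (s) => cv tip hv lq lt vs tvs tos nes st tm rs sp co out Bs1.
  case=> /= h1 h2 h3 h4 h5 h6 h7 h8 _ Ecv lt_hv; split=> //=; try by rewrite Ecv.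
  by exists b.
have Ehv1 : highest_voted_view (mark_voted_view s1) = cur_view (mark_voted_view s1).
  by case: (s1).
have {}Bs1 := ballots_ok_cast Is1 Ehv1 Bs1.
set b' := (X in ballots_ok X _) in Bs1.
have Bm : backed b' (MVote payload m).
  by exists T; [right |]; rewrite /m /s1; case: (s).
have send_m k := @hoare_send_backed b' now k _ Bm.
by have [] := send_m j' _ _ (send_m j _ _ (conj Is1 Bs1) erefl) erefl.
Qed.

Lemma adoptable_tip p T :
  valid_proposal sg p -> 0 < pr_view p ->
  (if fresh p then Some (tip_of p) else obind (@tc_high_tip f hash) (pr_tc p)) = Some T ->
  valid_fresh_tip sg T /\ tp_view T <= pr_view p.
Proof.
case=> _ _ _ _; case: ifP => [_ Vt _ [<-] //|_ [_ [c [t [-> Vc -> Et _]]]] _ /=].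
rewrite Et => -[<-]; case: c Vc Et => v tips ht qcs hq ks /= [_ Vc] Et.
by move: Vc; rewrite Et; case: hq => // -[? /leqW].
Qed.

Lemma hoare_proposal_tail now p :
  valid_proposal sg p -> 0 < pr_view p ->
  hoare (fun s => inv_at (pr_view p) s /\ highest_voted_view s < pr_view p)
   ((if fresh p then update (set_local_tip (tip_of p))
     else given (obind (@tc_high_tip f hash) (pr_tc p))
            (fun t => update (set_local_tip t))) ;;
    reading (fun s1 =>
      send now (leader (cur_view s1)) (MVote payload (own_vote H i s1)) ;;
      send now (leader (cur_view s1).+1) (MVote payload (own_vote H i s1))) ;;
    update (@mark_voted_view R f hash payload)) inv.
Proof.
move=> Vp p0 s s' [[Is Ecv] lt_hv] [s1 [Es1 tail]].
have [T eT Es1'] : exists2 T,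
    (if fresh p then Some (tip_of p) else obind (@tc_high_tip f hash) (pr_tc p)) = Some T
    & s1 = set_local_tip T s.
  move: (Vp) Es1 => [_ _ _ _]; case: ifP => _ Vp' Es1; first by exists (tip_of p).
  case: Vp' Es1 => _ [c [t [-> _ _ Et _]]] /=; rewrite Et /= => Es1.
  by exists t.
have [vT le_T] := adoptable_tip Vp p0 eT.
apply: (inv_vote Is Ecv lt_hv _ vT le_T Es1' tail).
by exists p.
Qed.

(** Collected votes agree only on the proposal id. As [H] is injective, they also agree on view and
    block hash, hence sign the same data. *)
Lemma valid_formed l x q :
  injective H -> (forall y, List.In y l -> valid_vote sg y) -> valid_vote sg x ->
  formed l x q -> valid_qc sg q.
Proof.
move=> injH Vl [Ex _] [A [-> [cA AP]]]; right; split=> //=; split=> // j /AP.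
case=> y [/Vl [Ey Sy] Ej Epid]; move: Sy; rewrite /vote_data Ej Epid.
by move: Epid; rewrite Ey Ex => /injH [-> ->].
Qed.

Lemma inv_add_vote x (s : state) : valid_vote sg x -> inv s -> inv (add_vote x s).
Proof.
case: s => cv tip hv lq lt vs tvs tos nes st tm rs sp co out Vx.
case=> /= h1 h2 h3 h4 h5 h6 h7 h8 [b [/= b1 b2 b3]].
by split=> //=; [move=> y [<-|/h5] | exists b].
Qed.

Lemma inv_add_tip_vote x (s : state) :
  valid_vote sg x -> inv s -> inv (add_tip_vote x s).
Proof.
case: s => cv tip hv lq lt vs tvs tos nes st tm rs sp co out Vx.
case=> /= h1 h2 h3 h4 h5 h6 h7 h8 [b [/= b1 b2 b3]].
by split=> //=; [move=> y [<-|/h6] | exists b].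
Qed.

Lemma inv_add_timeout M (s : state) : inv s -> inv (add_timeout M s).
Proof.
case: s => cv tip hv lq lt vs tvs tos nes st tm rs sp co out.
case=> /= h1 h2 h3 h4 h5 h6 h7 h8 [b [/= b1 b2 b3]].
by split=> //=; exists b.
Qed.

Lemma inv_add_ne x (s : state) : inv s -> inv (add_ne x s).
Proof.
case: s => cv tip hv lq lt vs tvs tos nes st tm rs sp co out.
case=> /= h1 h2 h3 h4 h5 h6 h7 h8 [b [/= b1 b2 b3]].
by split=> //=; exists b.
Qed.

Lemma header_qc_valid h q : valid_header sg h -> hd_qc h = Some q -> valid_qc sg q.
Proof. by case=> [->|[[q' [-> Vq]] _] [<-]]. Qed.

(** Without a TC the proposal must be fresh with a QC of the preceding view; a TC is of the
    preceding view by validity. The genesis header is excluded because it has no QC. *)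
Lemma proposal_cert_view p q :
  valid_proposal sg p -> hd_qc (pr_header p) = Some q ->
  pr_view p = (cert_view (if pr_tc p is Some c then CertTC c else CertQC q)).+1.
Proof.
case=> _ _ _ _; case: ifP => [_ /= Vt Eq|_ [_ [c [t [-> _ -> _ _]]]] //].
case: Vt => [[_ _ Eh _ _ _]|[_ _ _ _]].
  by move: Eq; rewrite /pr_header Eh.
case: eqP => [-> [-> _] /=|_]; first by rewrite /hd_qc_view Eq.
by case: (pr_tc p) => // c [_ ->].
Qed.

(** * Preservation of the invariant by each handler *)

Section Handlers.
Variables (theta_view theta_interval now : R) (kappa : nat) (sg0 : signing).
Hypothesis sg0_le : forall j d, sg0 j d -> sg j d.
Hypothesis injH : injective H.

Ltac quiet_solve := solve [rewrite ?/repropose ?/ProposeQC ?/request_proposal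
  ?/broadcast; repeat first
  [ quiet_step | apply: quiet_obtain | apply: quiet_propose
  | apply: quiet_BroadcastQC | apply: quiet_ProposeTC
  | apply: quiet_recovered
  | match goal with |- quiet (match ?x with _ => _ end) => case: x => * end ]].

Lemma hoare_on_proposal j p :
  hoare inv (on_proposal H leader genesis_payload theta_view i now sg0 j p) inv.
Proof.
apply: hoare_when => s s' [Is /(valid_proposal_mono sg0_le) Vp]; move: s s' Is.
apply: hoare_seq (hoare_quiet _) _; first quiet_solve.
apply: hoare_seq (hoare_quiet _) _; first quiet_solve.
apply: hoare_when_post => //; apply: hoare_given_post => [s []|q Eq] //.
move: (proposal_cert_view Vp Eq); set c := (X in cert_view X) => Ep.
have Vq : valid_qc sg q by case: Vp => -[Vh _] _ _ _ _; apply: header_qc_valid Eq.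
apply: hoare_seq (_ : hoare _ _ (inv_at (pr_view p))) _.
  rewrite Ep; apply: hoare_strengthen _ (hoare_Enter_at (erefl (cert_view c))).
  by move=> s [Is [_ le_s]].
apply: hoare_seq (hoare_at_quiet _) _; first quiet_solve.
apply: hoare_seq (hoare_Commit Vq) _.
apply: hoare_when_post => [s []|] //.
by apply: hoare_proposal_tail; rewrite ?Ep.
Qed.

Lemma hoare_on_vote x :
  hoare inv (on_vote H leader genesis_payload theta_view i now sg0 x) inv.
Proof.
apply: hoare_when => s s' [Is [/(valid_vote_mono sg0_le) Vx _ _]]; move: s s' Is.
apply: hoare_seq (hoare_update (fun s => inv_add_vote Vx)) _.
apply: hoare_ite; last exact: hoare_skip.
apply: hoare_drop.
apply: hoare_choose => q s s' [Is fq].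
have {fq} Vq := valid_formed injH (inv_votes Is) Vx fq; move: s s' Is.
apply: hoare_seq (hoare_Enter (c := _)) _.
apply: hoare_seq (hoare_Commit_inv Vq) _.
by apply: hoare_quiet; quiet_solve.
Qed.

Lemma hoare_on_qc j q :
  hoare inv (on_qc H leader genesis_payload theta_view i now sg0 j q) inv.
Proof.
apply: hoare_when => s s' [Is [/(valid_qc_mono sg0_le) Vq _]]; move: s s' Is.
apply: hoare_seq (_ : hoare inv _ inv) _.
  apply: hoare_when; apply: hoare_drop.
  apply: hoare_seq (hoare_Enter (c := _)) _.
  apply: hoare_seq (hoare_Commit_inv Vq) _.
  by apply: hoare_quiet; quiet_solve.
apply: hoare_seq (hoare_quiet _) _; first quiet_solve.
apply: hoare_when; apply: hoare_drop.
apply: hoare_seq (hoare_Enter (c := _)) _.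
apply: hoare_seq (hoare_Commit_inv Vq) _.
by apply: hoare_quiet; quiet_solve.
Qed.

Lemma hoare_on_timeout M :
  hoare inv (on_timeout H leader genesis_payload theta_view theta_interval kappa
               i now sg0 M) inv.
Proof.
apply: hoare_when => s s' [Is [VM _]]; move: s s' Is.
have [c0 [Ec0 Vc _]] : exists c, [/\ to_last_cer M = Some c,
    valid_cert H leader genesis_payload sg0 c & (cert_view c).+1 = to_view M].
  by case: VM.
(* Tip votes are recorded only from messages with a tip, for which validity of [M] covers the
   vote. *)
have Vx x : isSome (to_tip M) -> to_tip_vote M = Some x -> valid_vote sg x.
  case: VM => _ _; case: to_tip => // t; case: to_qc => // -[[y [-> Vy _]] _] _ [<-].
  exact: valid_vote_mono Vy.
apply: hoare_seq (_ : hoare inv _ inv) _.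
  apply: hoare_given => c; rewrite Ec0 => -[<-] {c}.
  apply: hoare_seq (hoare_quiet _) _; first by case: (c0) => *; quiet_solve.
  apply: hoare_seq (hoare_Enter (c := _)) _.
  apply: hoare_seq (hoare_quiet _) _; first by case: (c0) => *; quiet_solve.
  case: c0 Vc {Ec0} => [q /= /(valid_qc_mono sg0_le) Vq|c _]; last exact: hoare_skip.
  do 3![apply: hoare_seq (hoare_quiet _) _; first quiet_solve].
  exact: hoare_Commit_inv.
apply: hoare_seq (_ : hoare inv _ inv) _.
  case: to_tip Vx => [t|] Vx; last exact: hoare_skip.
  apply: hoare_given => x Ex; apply: hoare_update => s.
  by apply: inv_add_tip_vote; apply: Vx.
apply: hoare_ite.
  apply: hoare_drop.
  apply: hoare_choose => q s s' [Is [x [/Vx xP /xP {}Vx fq]]].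
  have {fq} Vq := valid_formed injH (inv_tip_votes Is) Vx fq; move: s s' Is.
  apply: hoare_seq (hoare_Enter (c := _)) _.
  apply: hoare_seq (hoare_Commit_inv Vq) _.
  by apply: hoare_quiet; quiet_solve.
apply: hoare_seq (hoare_update (inv_add_timeout M)) _.
apply: hoare_seq (_ : hoare inv _ inv) _.
  apply: hoare_when; apply: hoare_drop.
  exact: hoare_time_out.
apply: hoare_when; apply: hoare_drop.
apply: hoare_choose => c; apply: hoare_drop.
apply: hoare_seq (hoare_Enter (c := _)) _.
by apply: hoare_quiet; quiet_solve.
Qed.

Lemma hoare_on_tc c :
  hoare inv (on_tc H leader genesis_payload theta_view theta_interval kappa
               i now sg0 c) inv.
Proof.
apply: hoare_when; apply: hoare_drop.
apply: hoare_seq (hoare_Enter (c := _)) _.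
by apply: hoare_quiet; quiet_solve.
Qed.

Lemma hoare_on_request j c answer :
  (forall t, valid_tc sg c -> tc_high_tip c = Some t -> hoare inv (answer t) inv) ->
  hoare inv (on_request H leader genesis_payload theta_view now sg0 j c answer) inv.
Proof.
move=> ha; apply: hoare_when => s s' [Is [/(valid_tc_mono sg0_le) Vc _ _]].
move: s s' Is; apply: hoare_given => t Et.
by apply: hoare_seq (hoare_Enter (c := _)) _; apply: ha.
Qed.

Lemma hoare_receive j m :
  hoare inv (receive H leader genesis_payload theta_view theta_interval kappa
               i now sg0 j m) inv.
Proof.
apply: hoare_seq (hoare_quiet _) _; first quiet_solve.
case: m => [p|x|q|M|c|c|c|v u k].
- exact: hoare_on_proposal.
- exact: hoare_on_vote.
- exact: hoare_on_qc.
- exact: hoare_on_timeout.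
- exact: hoare_on_tc.
- by apply: hoare_on_request => t _ _; apply: hoare_quiet; quiet_solve.
- apply: hoare_on_request => t Vc Et; apply: hoare_when.
  apply: hoare_drop.
  exact: hoare_NE Vc _ Et _.
- apply: hoare_when; apply: hoare_drop.
  apply: hoare_seq (hoare_update (inv_add_ne _)) _.
  by apply: hoare_quiet; quiet_solve.
Qed.

End Handlers.

Lemma inv_start theta_view : old = [::] ->
  hoare (fun s => s = @blank R f hash payload H leader genesis_payload)
    (Defs.start H leader genesis_payload theta_view i 0%R) inv.
Proof.
move=> old0; apply: hoare_seq (_ : hoare _ _ inv) _; last first.
  by apply: hoare_quiet; apply: quiet_when; apply: quiet_propose.
(* The blank view is 0, so the guard of [Enter] holds and view 1 is entered; the history of ballots
   is empty. *)
move=> s s' -> [[_ ->]|[] //]; split=> //=; try by left.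
  by rewrite old0.
by exists (fun _ _ => False); split.
Qed.

End Invariant.

(** * Quorum intersection and safety *)

(** Two quorums share at least [2 * (2 * f + 1) - (3 * f + 1) = f + 1] validators, more than can be
    Byzantine. *)
Lemma quorums_meet (byz A B : {set V}) :
  #|byz| <= f -> #|A| = 2 * f + 1 -> #|B| = 2 * f + 1 ->
  exists j, [/\ j \in A, j \in B & j \notin byz].
Proof.
move=> byz_le cA cB.
suff /existsP[j /and3P[]] : [exists j, [&& j \in A, j \in B & j \notin byz]].
  by exists j.
apply: contraT.
rewrite negb_exists => /forallP noj.
have /subset_leq_card : A :&: B \subset byz.
  apply/subsetP => j; rewrite inE => /andP[jA jB].
  by have := noj j; rewrite jA jB /= negbK.
have le_U : #|A :|: B| <= 3 * f + 1 by rewrite -[leqRHS]card_ord max_card.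
by have := cardsUI A B; rewrite cA cB; lia.
Qed.

(* Ancestry is followed on hashes, so that no block with a given certified hash
   has to be exhibited. *)
Definition hash_parent (x y : hash) : Prop := exists w ph r u,
  y = H (HBlock payload w ph (Some r)) /\ qc_pid r = H (HProposal f payload x u).

Inductive hash_chain : nat -> hash -> hash -> Prop :=
  | hash_chain0 x : hash_chain 0 x x
  | hash_chainS n x y z :
      hash_chain n x y -> hash_parent y z -> hash_chain n.+1 x z.

Lemma hash_chain_trans n m x y z :
  hash_chain n x y -> hash_chain m y z -> hash_chain (m + n) x z.
Proof.
move=> xy yz; elim: yz xy => // {}m {}y u {}z _ IH uz xy.
exact: hash_chainS (IH xy) uz.
Qed.

Definition block_hash (B : block) : hash := hd_hash (bl_header B).

Definition well_hashed (B : block) : Prop :=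
  block_hash B = H (HBlock payload (hd_view (bl_header B)) (hd_payload (bl_header B))
                           (hd_qc (bl_header B))) /\
  hd_payload (bl_header B) = H (HPayload f hash (bl_payload B)).

Lemma points_to_well_hashed q p : points_to q p -> well_hashed (pr_block p).
Proof. by case=> -[]. Qed.

(** Every block of a chain except the last is pointed to by a QC, which makes it well hashed; the
    last one needs the hypothesis. *)
Lemma chain_hash n B B' : chain H n B B' -> well_hashed B' ->
  hash_chain n (block_hash B) (block_hash B') /\ well_hashed B.
Proof.
elim=> [{}B|{}n B1 B2 B3 _ IH [q [p [Eq qp Ep]]]] wB; first by split=> //; constructor.
have wB2 : well_hashed B2 by rewrite -Ep; apply: points_to_well_hashed qp.
have [chn wB1] := IH wB2; split=> //; apply: hash_chainS chn _.
have [-> _] := wB; have [[Epid _ _] Eqp] := qp.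
exists (hd_view (bl_header B3)), (hd_payload (bl_header B3)), q, (pr_view p).
by rewrite Eq -Eqp Epid /pr_header Ep.
Qed.

(** * Collision-freeness: hashes determine blocks and ancestors *)

Section Injectivity.
Hypothesis injH : injective H.

Lemma hash_parent_inj x y z : hash_parent x z -> hash_parent y z -> x = y.
Proof.
move=> [w [ph [r [u [-> Er]]]]] [w' [ph' [r' [u' [/injH [_ _ E] Er']]]]].
by move: Er'; rewrite -E Er => /injH [].
Qed.

Lemma hash_chain_inv n x z : hash_chain n x z ->
  n = 0 /\ x = z \/ exists m y, [/\ n = m.+1, hash_chain m x y & hash_parent y z].
Proof. by case=> [|m {}x y {}z]; [left | right; exists m, y]. Qed.

Lemma hash_chain_inj n x y z : hash_chain n x z -> hash_chain n y z -> x = y.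
Proof.
move=> xz; elim: xz y => [{}x|{}n {}x u {}z _ IH uz] y /hash_chain_inv [] [] //.
  by move=> m [? []].
by move=> m [u' [[<-] yu' /(hash_parent_inj uz) Eu]]; apply: IH; rewrite Eu.
Qed.

(** Both chains descend through the same unique parents and can only stop at the root. *)
Lemma root_chain_inj g n m z : (forall x, ~ hash_parent x g) ->
  hash_chain n g z -> hash_chain m g z -> n = m.
Proof.
move=> root gz; elim: gz root m => [{}g|{}n {}g y {}z _ IH yz] root m /hash_chain_inv [].
- by case.
- by move=> [k [y [_ _ /root]]].
- by move=> [_ Eg]; case: (root y); rewrite Eg.
- by move=> [k [u [-> gu /(hash_parent_inj yz) Eu]]]; rewrite (IH _ k) // Eu.
Qed.

Lemma genesis_no_parent x : ~ hash_parent x (block_hash genesis_block).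
Proof. by case=> w [ph [r [u [/injH]]]]. Qed.

Lemma block_hash_inj B1 B2 : well_hashed B1 -> well_hashed B2 ->
  block_hash B1 = block_hash B2 -> B1 = B2.
Proof.
case: B1 B2 => [[w ph oq h] pl] [[w' ph' oq' h'] pl'] [/= E1 E2] [/= E1' E2'] E.
rewrite /block_hash /= in E E1 E1'.
have := E; rewrite E1 E1' => /injH [-> Eph ->]; rewrite Eph.
by move: Eph; rewrite E2 E2' => /injH [->].
Qed.

End Injectivity.

(** * Signatures and certificates along an execution *)

Section Execution.
Variables (theta_view theta_interval : R) (kappa : nat) (byz : {set V}) (delta : R).
Variable run : nat -> config R f hash payload.
Variable ev : nat -> event f hash payload.
Variable tm : nat -> R.
Hypothesis injH : injective H.
Hypothesis byz_le : #|byz| <= f.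
Hypothesis exec : execution H leader genesis_payload theta_view theta_interval kappa
                    byz delta run ev tm.

(* Validity is judged by the signatures that verify at some time: this is the
   union of all [verifies byz (run k)], so it does not change during a step. *)
Definition signs (j : V) (d : signed_data hash) := exists k, verifies byz (run k) j d.

Local Notation inv := (inv signs).
Local Notation valid_qc := (valid_qc signs).
Local Notation valid_tc := (valid_tc signs).
Local Notation valid_header := (valid_header signs).
Local Notation valid_fresh_tip := (valid_fresh_tip signs).
Local Notation adoptable := (adoptable signs).
Local Notation backed := (backed signs).
Local Notation two_chain := (two_chain signs).

Lemma inv_step (old : seq packet) i k : i \notin byz ->
  inv old (local (run k) i) -> inv old (local (run k.+1) i).
Proof.
move=> iC Ii.
have step_i a i' : steps byz i' a (run k) (run k.+1) ->
    hoare (inv old) a (inv old) -> inv old (local (run k.+1) i).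
  case=> _ Ea Eother ha; have [Ei|ne_i] := eqVneq i i'; last by rewrite Eother.
  by rewrite -Ei in Ea; apply: ha Ea.
have le_signs j d : verifies byz (run k) j d -> signs j d by exists k.
have [_] := exec_step exec k; case: (ev k) => [j n|j i' m|i'|i'|].
- case=> t [i' [m [_ _ _ /step_i Ei _]]]; apply: Ei.
  exact: (hoare_receive le_signs injH).
- by case=> _ /step_i Ei _; apply: Ei; apply: (hoare_receive le_signs injH).
- by case=> _ /step_i Ei _; apply: Ei; apply: hoare_time_out.
- by case=> /step_i Ei _; apply: Ei; apply/hoare_quiet/quiet_ask_further.
- by case=> -> _.
Qed.

Lemma inv_run i k : i \notin byz -> inv [::] (local (run k) i).
Proof.
move=> iC; elim: k => [|k]; last exact: inv_step.
have [_ /(_ i iC) Es] := exec_init exec.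
exact: inv_start erefl _ _ erefl Es.
Qed.

Lemma sent_mono i k l x : i \notin byz -> k <= l ->
  List.In x (sent (local (run k) i)) -> List.In x (sent (local (run l) i)).
Proof.
move=> iC /subnKC <- xs.
suff /inv_old : inv (sent (local (run k) i)) (local (run (k + (l - k))) i) by apply.
elim: (l - k) => [|d IHd]; last by rewrite addnS; apply: inv_step.
by rewrite addn0; case: (inv_run k iC).
Qed.

(** The counterpart of [backed] for signed data, since certificates retain signatures but not the
    messages that carried them. *)
Definition signed (ballot : nat -> tip -> Prop) (d : signed_data hash) : Prop :=
  match d with
  | SVote w bh _ => exists2 T, ballot w T & bh = tip_hash T
  | SProposal _ => True
  | STimeout w tv qv => exists2 T, ballot w T &
      tv = Some (tp_view T) /\ qv = hd_qc_view (tp_header T) \/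
      tv = None /\ tp_view T <= qv
  | SNE w u =>
      exists c t, [/\ valid_tc c, w = (tc_view c).+1, tc_high_tip c = Some t
                    & u = hd_qc_view (tp_header t)]
  end.

Lemma backed_signed ballot j m d :
  backed ballot m -> produces j m d -> signed ballot d.
Proof.
case: m => //=.
- by move=> p _ [_ ->].
- by move=> x bx [_ ->].
- move=> M [bx [T bT rT]] [[_ ->]|[x [/bx ? _ ->]]] //=.
  exists T => //; case: rT => [Et|[Et le_T]]; [left | right]; rewrite Et //.
  by split=> //; rewrite /reported_qc_view Et.
- by move=> w u k bk [_ ->].
Qed.

(** At the later of the two times both messages are still among those sent, so a single ballot
    history explains both signatures. *)
Lemma two_signatures j d1 d2 : j \notin byz -> signs j d1 -> signs j d2 ->
  exists ballot s, [/\ ballots_ok signs ballot s, signed ballot d1 & signed ballot d2].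
Proof.
move=> jC [k [|E1]]; first by rewrite (negbTE jC).
move=> [l [|E2]]; first by rewrite (negbTE jC).
have [b Bs] := inv_ballots (inv_run (maxn k l) jC).
exists b, (local (run (maxn k l)) j); split=> //.
- have [t [i [m [/(sent_mono jC (leq_maxl k l)) /(sent_backed Bs)]]]] := E1.
  exact: backed_signed.
- have [t [i [m [/(sent_mono jC (leq_maxr k l)) /(sent_backed Bs)]]]] := E2.
  exact: backed_signed.
Qed.

Lemma valid_header_hash h : valid_header h ->
  hd_hash h = H (HBlock payload (hd_view h) (hd_payload h) (hd_qc h)).
Proof. by case=> [->|[_]]. Qed.

Lemma valid_fresh_tip_header T : valid_fresh_tip T -> valid_header (tp_header T).
Proof. by case: T => v pid h s oc on /= [[_ _ -> _ _ _]|[]]; [left|]. Qed.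

Lemma valid_fresh_tip_view T : valid_fresh_tip T ->
  T = genesis_tip \/
  hd_view (tp_header T) = tp_view T /\ hd_qc_view (tp_header T) < tp_view T.
Proof. by case: T => v pid h s oc on /= [->|[]]; [left | right]. Qed.

Lemma fresh_tip_qc T : valid_fresh_tip T -> 0 < tp_view T ->
  exists q, [/\ hd_qc (tp_header T) = Some q, valid_qc q & qc_view q < tp_view T].
Proof.
move=> VT T0; case: (valid_fresh_tip_view VT) => [ET|[Ev]]; first by rewrite ET in T0.
case: (valid_fresh_tip_header VT) => [Eh|[[q [Eq Vq]] _]].
  by move: T0; rewrite -Ev Eh.
by rewrite /hd_qc_view Eq; exists q.
Qed.

Lemma valid_qc_pid q : valid_qc q ->
  qc_pid q = H (HProposal f payload (qc_block q) (qc_view q)).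
Proof. by case=> [->|[]]. Qed.

Lemma points_to_block q p : valid_qc q -> points_to q p ->
  hd_hash (pr_header p) = qc_block q /\ pr_view p = qc_view q.
Proof. by move=> /valid_qc_pid Eq [[Ep _ _]]; rewrite Ep Eq => /injH [-> ->]. Qed.

(* Correct validators vote in positive views only. *)
Lemma qc_quorum q : valid_qc q -> q = genesis_qc \/
  0 < qc_view q /\ quorum (2 * f + 1) (qc_sigs q)
    (fun j => signs j (SVote (qc_view q) (qc_block q) (qc_pid q))).
Proof.
case=> [|[_ Q]]; [by left | right]; split=> //.
have [cA AP] := Q; have [j [/AP Sj _ jC]] := quorums_meet byz_le cA cA.
have [b [s [Bs [T bT _] _]]] := two_signatures jC Sj Sj.
by have [/andP[]] := ballot_tip Bs bT.
Qed.

(** A common correct voter has one tip per view; the genesis QC is kept apart by its view 0. *)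
Lemma qc_block_unique q r : valid_qc q -> valid_qc r -> qc_view q = qc_view r ->
  qc_block q = qc_block r.
Proof.
move=> /qc_quorum [->|[q0 [cA AP]]] /qc_quorum [->|[r0 [cB BP]]] // Ev.
- by rewrite -Ev in r0.
- by rewrite Ev in q0.
have [j [/AP Sq /BP Sr jC]] := quorums_meet byz_le cA cB.
have [b [s [Bs [T bT ->] [T' bT' ->]]]] := two_signatures jC Sq Sr.
have [->//|[x]] := ballot_later Bs bT bT' (eq_leq Ev).
by rewrite Ev => /andP[/leq_trans lt_x /lt_x]; rewrite ltnn.
Qed.

(** * Constraints that a committed block imposes on later views *)

Section TwoChain.
Variables q q' : qc.
Hypothesis qq' : two_chain q q'.
Local Notation v := (qc_view q').

Definition good (T : tip) : Prop :=
  [/\ valid_fresh_tip T, v <= hd_qc_view (tp_header T) & v < tp_view T].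

Lemma two_chain_quorum : #|qc_sigs q| = 2 * f + 1 /\
  forall j, j \in qc_sigs q -> signs j (SVote v.+1 (qc_block q) (qc_pid q)).
Proof.
have [par [Vq _ _ Ev]] := qq'; rewrite -Ev.
by case: (qc_quorum Vq) => [Eq|[_ Q]] //; rewrite Eq in Ev.
Qed.

Lemma two_chain_tip T : valid_fresh_tip T -> qc_block q = tip_hash T ->
  hd_qc (tp_header T) = Some q'.
Proof.
move=> /valid_fresh_tip_header/valid_header_hash EhT Eb.
have [par [Vq qP Eq' _]] := qq'; have [Ep _] := points_to_block Vq qP.
have [[_ Eh _] _] := qP.
by move: EhT; rewrite -/(tip_hash T) -Eb -Ep Eh => /injH [_ _ <-].
Qed.

(** [two_chain] assumes validity of [q] only. A correct voter behind [q] had a valid tip with the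
    certified hash, and the header of that tip contains [q']. *)
Lemma two_chain_valid : valid_qc q'.
Proof.
have [cA AP] := two_chain_quorum; have [j [/AP Sq _ jC]] := quorums_meet byz_le cA cA.
have [b [s [Bs [T bT Eb] _]]] := two_signatures jC Sq Sq.
have [_ _ VT _] := ballot_tip Bs bT.
exact: header_qc_valid (valid_fresh_tip_header VT) (two_chain_tip VT Eb).
Qed.

Lemma two_chain_good T : valid_fresh_tip T -> qc_block q = tip_hash T -> good T.
Proof.
move=> VT Eb; have Eq := two_chain_tip VT Eb.
have Ev : hd_qc_view (tp_header T) = v by rewrite /hd_qc_view Eq.
split; rewrite ?Ev //.
have [ET|[_]] := valid_fresh_tip_view VT; last by rewrite Ev.
by rewrite ET in Eq.
Qed.

Definition tc_good (w : nat) : Prop := forall c, valid_tc c -> tc_view c = w ->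
  (forall r, tc_high_qc c = Some r -> v <= qc_view r) /\
  (forall t, tc_high_tip c = Some t -> good t).

(** A fresh tip is justified by a QC of the preceding view, by the high QC of a TC, or by an NEC;
    each bounds the QC view from below. *)
Lemma late_tip_good T : valid_fresh_tip T -> v.+1 < tp_view T ->
  tc_good (tp_view T).-1 -> good T.
Proof.
case: T => x pid h s oc on VT lt_x; rewrite /= in lt_x *; move=> IH.
split=> //=; last exact: ltnW.
case: VT => /= [[Ex]|[_ _ _ _]]; first by rewrite Ex in lt_x.
case: eqP => [Ex _|_]; first by rewrite Ex ltnS in lt_x; apply: ltnW.
case: oc => [c|] // [Vc Ec]; rewrite Ec /= in IH; case: on => [n|]; last first.
  case=> r [Er Eh]; have [/(_ r Er) + _] := IH c Vc erefl.
  by rewrite /hd_qc_view Eh.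
(* The TC [c'] seen by a correct NEC signer may differ from [c], but has the same view, and
   [tc_good] speaks of all TCs of a view. *)
case=> -[_ [cA AP]] Ex ->.
have [k [/AP Sk _ kC]] := quorums_meet byz_le cA cA.
have [b [s' [_ [c' [t [Vc' Ec' Et ->]]] _]]] := two_signatures kC Sk Sk.
have E : tc_view c' = tc_view c by apply/succn_inj; rewrite -Ec' -Ex.
by have [_ /(_ t Et) []] := IH c' Vc' E.
Qed.

(** A fresh proposal yields a late tip; a reproposal yields the high tip of a TC of view [x - 1],
    which still exceeds [v]. *)
Lemma adoptable_good x T : v.+1 < x -> adoptable x T ->
  (forall w, v < w < x -> tc_good w) -> good T.
Proof.
move=> lt_x [p [[_ _ _ _ Vp] Ep ET]] IH; case: ifP Vp ET => _.
  move=> VT [ET]; rewrite -ET; apply: late_tip_good => //=; rewrite Ep //.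
  by apply: IH; case: (x) lt_x => //= n; rewrite !ltnS => ->; rewrite leqnn.
case=> _ [c [t [-> Vc Ex Et _]]] /=; rewrite Et => -[<-].
have [] := IH (tc_view c) _ c Vc erefl; last by move=> _; apply.
by rewrite -Ep Ex ltnSn andbT; move: lt_x; rewrite -Ep Ex ltnS.
Qed.

(* Voting for the child of the committed block in view [v + 1] ties the later
   ballots of a validator to [good] tips. *)
Lemma later_ballot_good ballot s w T :
  ballots_ok signs ballot s -> signed ballot (SVote v.+1 (qc_block q) (qc_pid q)) ->
  ballot w T -> v < w -> (forall w', v < w' < w -> tc_good w') -> good T.
Proof.
move=> Bs [T0 b0 E0] bT lt_w IH.
have [_ _ V0 _] := ballot_tip Bs b0.
have [->|[x /andP[lt_x le_x] aT]] := ballot_later Bs b0 bT lt_w.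
  exact: two_chain_good E0.
apply: adoptable_good lt_x aT _ => w' /andP[lt_w' lt_x'].
by apply: IH; rewrite lt_w' (leq_trans lt_x').
Qed.

Lemma all_tc_good w : v < w -> tc_good w.
Proof.
elim/ltn_ind: w => w IH lt_w [v0 tips ht qcs hq ks] Vc /= Ev.
have [[cB BP] Hc] := Vc; have [cA AP] := two_chain_quorum.
have [j [/AP Sq jB jC]] := quorums_meet byz_le cA cB.
have [b [s [Bs S1 [T bT rT]]]] := two_signatures jC Sq (BP j jB).
have [_ leT ltT] : good T.
  apply: later_ballot_good Bs S1 bT _ _; rewrite Ev //.
  by move=> w' /andP[lt_w' /IH]; apply.
case: ht Hc {Vc} => [t|]; case: hq => [r|] // [].
- move=> Vt le_t Htips Hqcs lt_max; split=> // t' [<-].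
  have le_j : qcs j < tp_view t by apply: leq_ltn_trans (leq_bigmax_cond _ jB) lt_max.
  have late : v.+1 < tp_view t -> good t.
    move=> lt_t; apply: late_tip_good => //; apply: IH; last by case: (tp_view t) lt_t.
    by rewrite -Ev; case: (tp_view t) lt_t le_t.
  (* If [j] reported a QC, or a tip of smaller view than [t], then [t] is beyond view [v + 1] and
     its own justification applies. If the views are equal, the tie-breaking rule makes the QC view
     of [t] at least that of [T]. *)
  case: rT => [[Et Eq]|[_ le_T]]; last first.
    by apply: late; apply: leq_ltn_trans le_j; apply: leq_trans le_T.
  have [_ le_t'] := Htips _ _ jB Et.
  move: le_t'; rewrite leq_eqVlt => /orP[/eqP E|lt_t]; last first.
    by apply: late; apply: leq_ltn_trans lt_t.
  by split; rewrite -?E //; apply: leq_trans (Hqcs j jB _); rewrite ?Eq // -E.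
- move=> _ _ _ Er; split=> // r' [<-]; rewrite Er.
  apply: leq_trans (leq_bigmax_cond _ jB).
  by case: rT => [[_ ->]|[_]] //; apply/leq_trans/ltnW.
Qed.

(** A correct voter common to [q] and [r] voted in the view of [r] for a good tip. The QC in its
    header has a smaller view, still at least [v], so induction applies to it. *)
Lemma later_qc_extends r : valid_qc r -> v <= qc_view r ->
  exists n, hash_chain n (qc_block q') (qc_block r).
Proof.
have Vq' := two_chain_valid.
have [w] := ubnP (qc_view r); elim: w r => // w IH r le_r Vr.
rewrite leq_eqVlt => /orP[/eqP Ev|lt_r].
  by exists 0; rewrite (qc_block_unique Vq' Vr Ev); constructor.
case: (qc_quorum Vr) => [Er|[_ [cB BP]]]; first by rewrite Er in lt_r.
have [cA AP] := two_chain_quorum.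
have [j [/AP Sq /BP Sr jC]] := quorums_meet byz_le cA cB.
have [b [s [Bs S1 [T bT ->]]]] := two_signatures jC Sq Sr.
have [VT leT ltT] : good T.
  by apply: later_ballot_good Bs S1 bT lt_r _ => w' /andP[/all_tc_good].
have [r' [Er' Vr' lt_r']] := fresh_tip_qc VT (leq_ltn_trans (leq0n v) ltT).
have [_ le_T _ _] := ballot_tip Bs bT.
have [n chn] : exists n, hash_chain n (qc_block q') (qc_block r').
  apply: IH Vr' _; last by move: leT; rewrite /hd_qc_view Er'.
  by apply: leq_trans lt_r' _; apply: leq_trans le_T _.
exists n.+1; apply: hash_chainS chn _.
have Eh := valid_header_hash (valid_fresh_tip_header VT).
rewrite Er' in Eh; rewrite /tip_hash Eh.
by exists (hd_view (tp_header T)), (hd_payload (tp_header T)), r', (qc_view r');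
  rewrite (valid_qc_pid Vr').
Qed.

End TwoChain.

(** * Agreement of the logs *)

Lemma run_committed i k B : i \notin byz -> List.In B (committed (local (run k) i)) ->
  committable signs B.
Proof. by move=> /inv_run -/(_ k) /inv_committed; apply. Qed.

Lemma committable_well_hashed B : committable signs B -> well_hashed B.
Proof. by move=> [q [q' [gp [_ /points_to_well_hashed + ->]]]]. Qed.

Lemma committable_connected B B' : committable signs B -> committable signs B' ->
  exists n, hash_chain n (block_hash B) (block_hash B') \/
            hash_chain n (block_hash B') (block_hash B).
Proof.
have half q q' gp r r' gp' : two_chain q q' -> points_to q' gp ->
    two_chain r r' -> points_to r' gp' -> qc_view q' <= qc_view r' ->
    exists n, hash_chain n (block_hash (pr_block gp)) (block_hash (pr_block gp')).
  move=> qq' qP rr' rP le_v.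
  have Vq := two_chain_valid qq'; have Vr := two_chain_valid rr'.
  have [Eq _] := points_to_block Vq qP; have [Er _] := points_to_block Vr rP.
  rewrite /block_hash -/(pr_header gp) -/(pr_header gp') Eq Er.
  exact: (later_qc_extends qq' Vr le_v).
move=> [q [q' [gp [qq' qP ->]]]] [r [r' [gp' [rr' rP ->]]]].
case: (leqP (qc_view q') (qc_view r')) => [le_v|/ltnW le_v].
  by have [n ch] := half _ _ _ _ _ _ qq' qP rr' rP le_v; exists n; left.
by have [n ch] := half _ _ _ _ _ _ rr' rP qq' qP le_v; exists n; right.
Qed.

(** Both blocks lie on chains to the higher of the two committed blocks. Its distance from genesis
    is unique and both blocks are [h] above genesis, so they are ancestors of it at equal distance
    and have equal hashes. *)
Lemma log_consistent i j k l h B1 B2 : i \notin byz -> j \notin byz ->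
  in_log H genesis_payload (local (run k) i) h B1 ->
  in_log H genesis_payload (local (run l) j) h B2 -> B1 = B2.
Proof.
move=> iC jC [[ch1 _] [B1' [n1 [/(run_committed iC) C1 up1]]]].
move=> [[ch2 _] [B2' [n2 [/(run_committed jC) C2 up2]]]].
have [hup1 W1] := chain_hash up1 (committable_well_hashed C1).
have [hup2 W2] := chain_hash up2 (committable_well_hashed C2).
have [hch1 _] := chain_hash ch1 W1; have [hch2 _] := chain_hash ch2 W2.
apply: block_hash_inj => //.
have [m [mid|mid]] := committable_connected C1 C2.
- have up := hash_chain_trans hup1 mid.
  have := root_chain_inj injH (genesis_no_parent injH)
    (hash_chain_trans hch1 up) (hash_chain_trans hch2 hup2).
  by move=> /addIn E; rewrite E in up; apply: hash_chain_inj up hup2.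
- have up := hash_chain_trans hup2 mid.
  have := root_chain_inj injH (genesis_no_parent injH)
    (hash_chain_trans hch1 hup1) (hash_chain_trans hch2 up).
  by move=> /addIn E; rewrite E in hup1; apply: hash_chain_inj hup1 up.
Qed.

End Execution.
End Safety.

Theorem theorem1 (R : realType) (f : nat) (hash payload : Type)
    (H : hash_input f hash payload -> hash)
    (leader : nat -> validator f)
    (genesis_payload : payload)
    (delta theta_view theta_interval : R) (kappa : nat)
    (byz : {set validator f})
    (run : nat -> config R f hash payload)
    (ev : nat -> event f hash payload)
    (tm : nat -> R) :
  injective H ->
  round_robin leader ->
  (0 < delta)%R ->
  #|byz| <= f ->
  execution H leader genesis_payload theta_view theta_interval kappa byz delta
    run ev tm ->
  forall (i j : validator f) (k l h : nat) (B1 B2 : block f hash payload),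
    i \notin byz -> j \notin byz ->
    in_log H genesis_payload (local (run k) i) h B1 ->
    in_log H genesis_payload (local (run l) j) h B2 ->
    B1 = B2.
Proof.
move=> injH _ _ byz_le exec i j k l h B1 B2.
exact: log_consistent injH byz_le exec i j k l h B1 B2.
Qed.
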